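(* Let $X$ be a compact Hausdorff space and let $\mathcal{M}\subset C(X)$ be a unital function space. Assume that $C(X)$ is the $C^*$-envelope of $\mathcal{M}$. Then the following statements are equivalent. (i) Whenever $\pi:C(X)\rightarrow B(\mathcal{H}_\pi)$ is a $*$-representation possessing the approximate unique extension property with respect to $\mathcal{M}$ and $\psi:C(X)\rightarrow B(\mathcal{H}_\pi)$ is a unital completely positive map such that $C^*(\mathrm{Im}\,\psi)$ is commutative and $\psi|_{\mathcal{M}}=\pi|_{\mathcal{M}}$, we have $\psi=\pi$. (ii) Whenever $\psi_\alpha:C(X)\rightarrow C(X)$ is a net of unital completely positive maps satisfying $\|\psi_\alpha(g)-g\|\rightarrow0$ for every $g\in\mathcal{M}$, we have $\|\psi_\alpha(f)-f\|\rightarrow0$ for every $f\in C(X)$. (iii) Every irreducible $*$-representation of $C(X)$ is a boundary representation for $\mathcal{M}$.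
   Context: A unital function space is a linear subspace of $C(X)$ containing the constant function $1$. $*$-representations of unital $C^*$-algebras are on Hilbert spaces and are unital. For a unital operator space $\mathcal{M}$ generating a unital $C^*$-algebra $\mathfrak{A}=C^*(\mathcal{M})$: a $*$-representation $\pi:\mathfrak{A}\to B(\mathcal{H}_\pi)$ has the unique extension property with respect to $\mathcal{M}$ if, whenever $\psi:\mathfrak{A}\to B(\mathcal{H}_\pi)$ is unital completely positive with $\psi|_{\mathcal{M}}=\pi|_{\mathcal{M}}$, then $\psi=\pi$; if in addition $\pi$ is irreducible, it is a boundary representation for $\mathcal{M}$. It has the approximate unique extension property with respect to $\mathcal{M}$ if, for every such $\psi$, there is a net of unitaries $u_\beta\in B(\mathcal{H}_\pi)$ with $u_\beta^*\psi(t)u_\beta\to\pi(t)$ in the weak operator topology for every $t\in\mathfrak{A}$. A $C^*$-cover of $\mathcal{M}$ is a pair $(\mathfrak{A},\iota)$ with $\iota:\mathcal{M}\to B(\mathcal{K})$ unital completely isometric linear and $\mathfrak{A}=C^*(\iota(\mathcal{M}))$. The $C^*$-envelope is a $C^*$-cover $(C^*_e(\mathcal{M}),\varepsilon)$ such that for every $C^*$-cover $(\mathfrak{A},\iota)$ there is a $*$-homomorphism $\theta:\mathfrak{A}\to C^*_e(\mathcal{M})$ with $\theta\circ\iota=\varepsilon$. ''$C(X)$ is the $C^*$-envelope of $\mathcal{M}$'' means that $C(X)$ with the inclusion $\mathcal{M}\subset C(X)$ has this property (in particular $\mathcal{M}$ generates $C(X)$). $C^*(\mathrm{Im}\,\psi)\subset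 B(\mathcal{H}_\pi)$ is the $C^*$-algebra generated by $\mathrm{Im}\,\psi$. *)

(* Defs.v *)
From HB Require Import structures.
From mathcomp Require Import all_boot all_order all_algebra.
From mathcomp Require Import boolp classical_sets functions reals topology.
From mathcomp Require Import normedtype sesquilinear.
From mathcomp Require Import complex.

Set Implicit Arguments.
Unset Strict Implicit.
Unset Printing Implicit Defensive.

Import Order.TTheory GRing.Theory Num.Theory.
Import numFieldNormedType.Exports.

Local Open Scope classical_set_scope.
Local Open Scope ring_scope.
Local Open Scope complex_scope.

(* The norm of a normed space over R[i] takes values in R[i]; this is the same
   norm, as an element of R. *)
Definition rnorm (R : realType) (V : normedModType R[i]) (x : V) : R :=
  complex.Re `|x|.

(* Norm of the Hilbert direct sum of n copies of V. *)
Definition l2norm (R : realType) (V : normedModType R[i]) (n : nat)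
    (v : 'I_n -> V) : R :=
  Num.sqrt (\sum_i rnorm (v i) ^+ 2).

(* The inner product is linear in its first argument. *)
Structure hilbertType (R : realType) := Hilbert {
  hsort :> completeNormedModType R[i];
  inner : {dot hsort for (@Num.conj R[i])};
  inner_norm : forall x : hsort, `|x| ^+ 2 = inner x x }.

Notation "''<' x , y >" := (inner _ x y)
  (at level 0, x at level 69, y at level 69, format "''<' x ,  y >") : ring_scope.

(* Nets are indexed by directed sets; [tails D] is the filter of eventual
   properties, so that a net u converges to l when u @ tails D --> l. *)
Structure directedType := Directed {
  dsort :> Type;
  dle : dsort -> dsort -> Prop;
  dle_inh : inhabited dsort;
  dle_refl : forall a, dle a a;
  dle_trans : forall a b c, dle a b -> dle b c -> dle a c;
  dle_ub : forall a b, exists c, dle a c /\ dle b c }.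

Definition tails (D : directedType) : set_system D :=
  [set P | exists a0, forall a, dle a0 a -> P a].
Arguments tails D : clear implicits.

Notation "'C(' X ; R )" := (continuousType X R[i]^o)
  (at level 0, X at level 99, R at level 99, format "'C(' X ;  R )") : type_scope.

Section ContinuousFunctions.
Context {R : realType} {X : topologicalType}.

Definition cts : {pred X -> R[i]^o} := mem [set f | continuous f].

Section Sub.
Context (f : X -> R[i]^o) (fP : f \in cts).
Definition cts_Sub_subproof := @isContinuous.Build X R[i]^o f (set_mem fP).
#[local] HB.instance Definition _ := cts_Sub_subproof.
Definition cts_Sub : C(X; R) := f.
End Sub.

Lemma cts_rect (K : C(X; R) -> Type) :
  (forall f (Pf : f \in cts), K (cts_Sub Pf)) -> forall u, K u.
Proof.
move=> Ksub [f [[Pf]]]; have fP : f \in cts by rewrite inE.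
have -> : Pf = set_mem fP by exact: Prop_irrelevance.
exact: Ksub.
Qed.

Lemma cts_valP f (Pf : f \in cts) : cts_Sub Pf = f :> (_ -> _).
Proof. by []. Qed.

HB.instance Definition _ := isSub.Build _ _ C(X; R) cts_rect cts_valP.

Lemma cts_subring_closed : subring_closed cts.
Proof.
split=> [|f g /set_mem cf /set_mem cg|f g /set_mem cf /set_mem cg];
    apply/mem_set => x.
- exact: (@cst_continuous X R[i]^o).
- by have := @continuousB R[i] R[i]^o X f g x (cf x) (cg x).
- by have := @continuousM R[i] X f g x (cf x) (cg x).
Qed.

HB.instance Definition _ :=
  GRing.isSubringClosed.Build (X -> R[i]^o) cts cts_subring_closed.
HB.instance Definition _ :=
  GRing.SubChoice_isSubComPzRing.Build _ _ C(X; R) cts_subring_closed.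

Lemma cts_scaler_closed : GRing.scaler_closed cts.
Proof.
move=> a f /set_mem cf; apply/mem_set => x.
have ca : {for x, continuous (cst a : X -> R[i]^o)}.
  exact: (@cst_continuous X R[i]^o).
by have := @continuousM R[i] X _ f x ca (cf x).
Qed.

HB.instance Definition _ :=
  GRing.isScaleClosed.Build R[i] (X -> R[i]^o) cts cts_scaler_closed.
HB.instance Definition _ := [SubZmodule_isSubLmodule of C(X; R) by <:].

Lemma cconj_continuous (f : C(X; R)) :
  continuous (fun x => Num.conj (f x : R[i]) : R[i]^o).
Proof.
move=> x; apply/(@cvgrPdist_lt R[i] R[i]^o) => e e0.
have /(@cvgrPdist_lt R[i] R[i]^o)/(_ e e0) := @cts_fun _ _ f x.
by apply: filterS => y; rewrite -rmorphB norm_conjC.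
Qed.

Definition cconj (f : C(X; R)) : C(X; R) := mkcts (@cconj_continuous f).

Definition supnorm (f : C(X; R)) : R := sup [set rnorm (f x) | x in [set: X]].

End ContinuousFunctions.

Section BoundedOperators.
Context {R : realType} {H : hilbertType R}.

Definition blin : {pred H -> H} := mem [set T | linear T /\ continuous T].

Structure bop := Bop { bop_fun :> H -> H; _ : bop_fun \in blin }.

HB.instance Definition _ := [isSub for bop_fun].
HB.instance Definition _ := [Choice of bop by <:].

Lemma blin_submod_closed : submod_closed blin.
Proof.
split=> [|a S T /set_mem[lS cS] /set_mem[lT cT]]; apply/mem_set; split.
- by move=> a x y; rewrite scaler0 addr0.
- by move=> x; exact: (@cst_continuous H H).
- move=> b x y; rewrite /= -[LHS]/(a *: S (b *: x + y) + T (b *: x + y)).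
  rewrite -[RHS]/(b *: (a *: S x + T x) + (a *: S y + T y)).
  rewrite lS lT !scalerDr !scalerA [b * a]mulrC -!addrA; congr (_ + _).
  by rewrite addrCA.
- move=> x; apply: (@continuousD R[i] H H (a \*: S) T x _ (cT x)).
  apply: (@continuousZ R[i] H H (cst a) S x) (cS x).
  exact: (@cst_continuous H R[i]^o).
Qed.

HB.instance Definition _ :=
  GRing.isSubmodClosed.Build R[i] (H -> H) blin blin_submod_closed.
HB.instance Definition _ := [SubChoice_isSubLmodule of bop by <:].

Lemma bopP (S T : bop) : S = T <-> S =1 T.
Proof. by split=> [->//|ST]; apply/val_inj/funext. Qed.

Lemma bop_linear (T : bop) : linear T.
Proof. by case: T => T /= /set_mem[]. Qed.

Lemma bop_continuous (T : bop) : continuous T.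
Proof. by case: T => T /= /set_mem[]. Qed.

Lemma bop1_subproof : idfun \in blin.
Proof. by apply/mem_set; split=> // x. Qed.

Lemma bopM_subproof (S T : bop) : S \o T \in blin.
Proof.
apply/mem_set; split=> [a x y|x] /=.
  by rewrite bop_linear bop_linear.
by apply: continuous_comp; exact: bop_continuous.
Qed.

Definition bop1 : bop := Bop bop1_subproof.
Definition bopM (S T : bop) : bop := Bop (bopM_subproof S T).

Let bopMA : associative bopM. Proof. by move=> S T U; exact/bopP. Qed.
Let bop1M : left_id bop1 bopM. Proof. by move=> T; exact/bopP. Qed.
Let bopM1 : right_id bop1 bopM. Proof. by move=> T; exact/bopP. Qed.
Let bopMDl : left_distributive bopM +%R.
Proof. by move=> S T U; exact/bopP. Qed.
Let bopMDr : right_distributive bopM +%R.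
Proof.
move=> S T U; apply/bopP => x.
rewrite -[LHS]/(S (T x + U x)) -[RHS]/(S (T x) + S (U x)).
by have := bop_linear S 1 (T x) (U x); rewrite !scale1r.
Qed.

HB.instance Definition _ :=
  GRing.Zmodule_isPzRing.Build bop bopMA bop1M bopM1 bopMDl bopMDr.

(* The adjoint: it exists, and is unique, by the Riesz representation theorem. *)
Definition adj (T : bop) : bop :=
  xget 0 [set S : bop | forall x y : H, '<T x, y> = '<x, S y> ].

Definition opnorm (T : bop) : R :=
  sup [set rnorm (T x) | x in [set x : H | rnorm x <= 1]].

Definition unitary (u : bop) : Prop := adj u * u = 1 /\ u * adj u = 1.

End BoundedOperators.
Arguments bop {R} H.
Notation "'B(' H )" := (bop H)
  (at level 0, H at level 99, format "'B(' H )") : type_scope.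

Section Generated.
Context {R : realType} {A : lmodType R[i]}.
Variables (mul : A -> A -> A) (star : A -> A) (nrm : A -> R).

Definition cstar_subalgebra (B : set A) : Prop :=
  [/\ B 0, forall a x y, B x -> B y -> B (a *: x + y),
      forall x y, B x -> B y -> B (mul x y),
      forall x, B x -> B (star x)
    & forall x, (forall e, 0 < e -> exists2 y, B y & nrm (x - y) < e) -> B x].

Definition cstar_generated (S : set A) : set A := smallest cstar_subalgebra S.

End Generated.

Definition cstar_CX {R : realType} {X : topologicalType} (S : set C(X; R)) :=
  @cstar_generated R C(X; R) *%R cconj supnorm S.

Definition cstar_BH {R : realType} {H : hilbertType R} (S : set B(H)) :=
  @cstar_generated R B(H) *%R adj opnorm S.

Section Matrices.
Context {R : realType} {X : topologicalType} {H : hilbertType R} {n : nat}.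

(* M_n(C(X)) is identified with the continuous functions X -> M_n(R[i]), and
   M_n(B(H)) with the bounded operators on the direct sum of n copies of H. *)

Definition mxsupnorm (F : 'M[C(X; R)]_n) : R :=
  sup [set r | exists x (v : 'I_n -> R[i]^o),
    l2norm v <= 1 /\ r = l2norm (fun i => \sum_j (F i j x * v j : R[i]^o))].

Definition mxopnorm (T : 'M[B(H)]_n) : R :=
  sup [set l2norm (fun i => \sum_j T i j (v j)) |
    v in [set v : 'I_n -> H | l2norm v <= 1]].

Definition mxpos_CX (F : 'M[C(X; R)]_n) : Prop :=
  forall x (v : 'I_n -> R[i]),
    0 <= \sum_i \sum_j (F i j x : R[i]) * v j * Num.conj (v i).

Definition mxpos_BH (T : 'M[B(H)]_n) : Prop :=
  forall v : 'I_n -> H, 0 <= \sum_i '<\sum_j T i j (v j), v i>.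

End Matrices.

Section Maps.
Context {R : realType} {X : topologicalType}.

Definition ucp_CX (psi : C(X; R) -> C(X; R)) : Prop :=
  [/\ linear psi, psi 1 = 1
    & forall n (F : 'M[C(X; R)]_n), mxpos_CX F -> mxpos_CX (map_mx psi F)].

Definition ucp {H : hilbertType R} (psi : C(X; R) -> B(H)) : Prop :=
  [/\ linear psi, psi 1 = 1
    & forall n (F : 'M[C(X; R)]_n), mxpos_CX F -> mxpos_BH (map_mx psi F)].

Definition star_rep {H : hilbertType R} (pi : C(X; R) -> B(H)) : Prop :=
  [/\ linear pi, pi 1 = 1, forall f g, pi (f * g) = pi f * pi g
    & forall f, pi (cconj f) = adj (pi f)].

Definition irreducible {H : hilbertType R} (pi : C(X; R) -> B(H)) : Prop :=
  (exists x : H, x != 0) /\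
  forall V : set H,
    [/\ V 0, forall a x y, V x -> V y -> V (a *: x + y), closed V
      & forall f x, V x -> V (pi f x)] ->
    V = [set 0] \/ V = setT.

Definition unital_function_space (M : set C(X; R)) : Prop :=
  M 1 /\ forall a f g, M f -> M g -> M (a *: f + g).

Variable M : set C(X; R).

(* Maps on M and on C*-subalgebras are represented by maps on the ambient
   space, whose values elsewhere are irrelevant. *)

Definition cstar_cover {K : hilbertType R} (iota : C(X; R) -> B(K)) : Prop :=
  [/\ forall a f g, M f -> M g -> iota (a *: f + g) = a *: iota f + iota g,
      iota 1 = 1
    & forall n (F : 'M[C(X; R)]_n), (forall i j, M (F i j)) ->
        mxopnorm (map_mx iota F) = mxsupnorm F].

Definition star_hom {K : hilbertType R} (A : set B(K))
    (theta : B(K) -> C(X; R)) : Prop :=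
  [/\ forall a S T, A S -> A T -> theta (a *: S + T) = a *: theta S + theta T,
      forall S T, A S -> A T -> theta (S * T) = theta S * theta T
    & forall T, A T -> theta (adj T) = cconj (theta T)].

Definition is_cstar_envelope : Prop :=
  cstar_CX M = setT /\
  forall (K : hilbertType R) (iota : C(X; R) -> B(K)), cstar_cover iota ->
    exists2 theta, star_hom (cstar_BH (iota @` M)) theta
      & forall g, M g -> theta (iota g) = g.

Definition unique_extension {H : hilbertType R} (pi : C(X; R) -> B(H)) : Prop :=
  forall psi : C(X; R) -> B(H), ucp psi -> (forall g, M g -> psi g = pi g) -> psi = pi.

Definition approx_unique_extension {H : hilbertType R}
    (pi : C(X; R) -> B(H)) : Prop :=
  forall psi : C(X; R) -> B(H), ucp psi -> (forall g, M g -> psi g = pi g) ->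
  exists (D : directedType) (u : D -> B(H)), (forall b, unitary (u b)) /\
    forall (t : C(X; R)) (x y : H),
      ('<(adj (u b) * psi t * u b : B(H)) x, y> : R[i]^o) @[b --> tails D]
        --> ('<pi t x, y> : R[i]^o).

Definition boundary_rep {H : hilbertType R} (pi : C(X; R) -> B(H)) : Prop :=
  [/\ star_rep pi, unique_extension pi & irreducible pi].

End Maps.

(* Main.v *)
Require Import Defs.
From HB Require Import structures.
From mathcomp Require Import all_boot all_order all_algebra.
From mathcomp Require Import finmap.
From mathcomp Require Import boolp classical_sets functions reals topology.
From mathcomp Require Import normedtype sesquilinear complex.
From mathcomp Require Import realfun summability.
From mathcomp Require Import ring lra.

(* Call x in X a Choquet point when evaluation at x is the only state of C(X)
   which extends its restriction to M. All three statements are equivalent to: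
   every point of X is a Choquet point.

   (iii) Irreducible representations of C(X) are evaluations f |-> f(x) 1, and
   f |-> <psi(f) v, v> is a state for every unital completely positive psi.

   (ii) If x is a Choquet point then, by Hahn-Banach, f(x) is the infimum of
   Re g(x) over the g in M with Re g >= f; Korovkin's argument and compactness
   follow. Conversely, a state phi extending evaluation at x on M gives the net
   f |-> (1 - h) f + phi(f) h, where h is a bump function shrinking to x.

   (i) If all points are Choquet points then psi(f) <= pi(Re g_i) for finitely
   many g_i in M with min Re g_i <= f + e; as psi(f) commutes with pi(C(X)), a
   partition of unity yields psi(f) <= pi(f) + e. Conversely, suppose that x0 is
   not a Choquet point and let C(X) act diagonally on l2(I), where I consists of
   x0 and the Choquet points. Any extension of pi|_M is diagonal, equal to pi
   except at x0, and the reflection exchanging the basis vectors of x0 and of a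
   Choquet point y carries it to pi in the weak operator limit y -> x0. So pi has
   the approximate unique extension property, while changing the evaluation at
   x0 into another state gives a psi <> pi with commutative range.

   Such y exist since the Choquet points are dense: a Zorn argument on closed
   sets carrying all their representing measures shows that Re g attains its
   maximum at a Choquet point for every g in M, so restriction to the Choquet
   points is a C*-cover of M, and the C*-envelope property makes it injective. *)

Import Order.TTheory GRing.Theory Num.Theory.
Import numFieldNormedType.Exports.

Local Open Scope classical_set_scope.
Local Open Scope ring_scope.
Local Open Scope complex_scope.

Set Implicit Arguments.
Unset Strict Implicit.
Unset Printing Implicit Defensive.

#[local] Existing Instance totally_filter.

(** * Complex-valued continuous functions *)

Section RealNorm.
Context {R : realType}.

Lemma ger0_complexE (z : R[i]) : 0 <= z -> z = (complex.Re z)%:C.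
Proof. by case: z => a b; rewrite lecE /= => /andP[/eqP -> _]. Qed.

Lemma gtr0_complexP (z : R[i]) : 0 < z -> 0 < complex.Re z /\ z = (complex.Re z)%:C.
Proof. by case: z => a b; rewrite ltcE /= => /andP[/eqP -> ?]. Qed.

Context {V : normedModType R[i]}.
Implicit Types x y : V.

Lemma rnormE x : (rnorm x)%:C = `|x|.
Proof. by rewrite /rnorm -ger0_complexE. Qed.

Lemma rnorm_ge0 x : 0 <= rnorm x.
Proof. by rewrite -ler0c rnormE. Qed.

Lemma rnorm0 : rnorm (0 : V) = 0.
Proof. by rewrite /rnorm normr0. Qed.

Lemma rnormN x : rnorm (- x) = rnorm x.
Proof. by rewrite /rnorm normrN. Qed.

Lemma rnormD x y : rnorm (x + y) <= rnorm x + rnorm y.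
Proof. by rewrite -lecR rmorphD /= !rnormE ler_normD. Qed.

Lemma rnorm_eq0 x : rnorm x = 0 -> x = 0.
Proof. by move=> h; apply/eqP; rewrite -normr_eq0 -rnormE h. Qed.

Lemma rnormZ (a : R[i]) x : rnorm (a *: x) = rnorm (a : R[i]^o) * rnorm x.
Proof. by apply: (@complexI R); rewrite rmorphM /= !rnormE normrZ. Qed.

Lemma cvg_rnormP (T : Type) (F : set_system T) {FF : Filter F} (f : T -> V) (l : V) :
  f @ F --> l <-> forall e : R, 0 < e -> \forall t \near F, rnorm (l - f t) < e.
Proof.
split.
  move=> /cvgrPdist_lt h e e0; have := h e%:C; rewrite ltcR => /(_ e0).
  by apply: filterS => t; rewrite -rnormE ltcR.
move=> h; apply/cvgrPdist_lt => e /gtr0_complexP[e0 ->].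
by apply: filterS (h _ e0) => t; rewrite -rnormE ltcR.
Qed.

Lemma near_rnorm x (e : R) : 0 < e -> \forall y \near x, rnorm (x - y) < e.
Proof. by have /cvg_rnormP := @cvg_id _ (nbhs x); exact. Qed.

End RealNorm.

Section ComplexContinuity.
Context {R : realType}.

Lemma rnormC (r : R) : rnorm (r%:C : R[i]^o) = `|r|.
Proof. by rewrite /rnorm normc_def /= expr0n addr0 sqrtr_sqr. Qed.

Lemma rnorm_Re (z : R[i]^o) : `|complex.Re (z : R[i])| <= rnorm z.
Proof. by rewrite -lecR rnormE; exact: normc_ge_Re. Qed.

Lemma rnorm_Im (z : R[i]^o) : `|complex.Im (z : R[i])| <= rnorm z.
Proof.
rewrite /rnorm normc_def /= -sqrtr_sqr ler_wsqrtr // lerDr.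
exact: sqr_ge0.
Qed.

Lemma rnorm_i : rnorm ('i%C : R[i]^o) = 1.
Proof. by rewrite /rnorm normc_def /= expr0n expr1n add0r sqrtr1. Qed.

Lemma rnorm_le_Re_Im (z : R[i]^o) :
  rnorm z <= `|complex.Re (z : R[i])| + `|complex.Im (z : R[i])|.
Proof.
have := rnormD ((complex.Re (z : R[i]))%:C : R[i]^o)
  ('i%C *: ((complex.Im (z : R[i]))%:C : R[i]^o)).
by rewrite rnormZ !rnormC rnorm_i mul1r -[X in rnorm X <= _ -> _](complexE (z : R[i])).
Qed.

Lemma continuous_realC : continuous (fun r : R => r%:C : R[i]^o).
Proof.
move=> r; apply/cvg_rnormP => e e0.
have /cvgrPdist_lt/(_ e e0) : (fun r : R => r) @ r --> r by [].
by apply: filterS => s; rewrite -rmorphB rnormC.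
Qed.

Lemma continuous_Re : continuous (fun z : R[i]^o => complex.Re (z : R[i])).
Proof.
move=> z; apply/(@cvgrPdist_lt R R^o _ _ (nbhs_filter z)) => e e0.
have zw := @near_rnorm _ R[i]^o z _ e0.
apply: (@filterS _ _ (nbhs_filter (z : R[i]^o)) _ _ _ zw) => w /=.
apply: le_lt_trans.
by rewrite -[X in `|X|](raddfB (@complex.Re R : Rcomplex R -> R)); exact: rnorm_Re.
Qed.

Lemma continuous_Im : continuous (fun z : R[i]^o => complex.Im (z : R[i])).
Proof.
move=> z; apply/(@cvgrPdist_lt R R^o _ _ (nbhs_filter z)) => e e0.
have zw := @near_rnorm _ R[i]^o z _ e0.
apply: (@filterS _ _ (nbhs_filter (z : R[i]^o)) _ _ _ zw) => w /=.
apply: le_lt_trans.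
by rewrite -[X in `|X|](raddfB (@complex.Im R : Rcomplex R -> R)); exact: rnorm_Im.
Qed.

End ComplexContinuity.

(** If [P] fails on the whole space, the sets whose complement satisfies [P] form a proper filter,
    and the local hypothesis is contradicted at a cluster point. This form of compactness replaces
    finite subcovers throughout. *)
Lemma compact_induction (X : topologicalType) (P : set (set X)) :
  compact [set: X] -> P set0 -> (forall A B, A `<=` B -> P B -> P A) ->
  (forall A B, P A -> P B -> P (A `|` B)) ->
  (forall x : X, exists2 U : set X, nbhs x U & P U) -> P [set: X].
Proof.
move=> cX P0 PS PU Px; apply: contrapT => nP.
pose F : set_system X := [set A | P (~` A)].
have FF : ProperFilter F.
  split; first by rewrite /F /= setC0.
  split=> /=; first by rewrite /F /= setCT.
    by move=> A B; rewrite /F /= setCI => ? ?; exact: PU.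
  by move=> A B AB; apply: PS; exact: subsetC.
have FT : F setT by rewrite /F /= setCT.
have [x [_ clx]] := cX F FF FT.
have [U xU PUx] := Px x.
have FU : F (~` U) by rewrite /F /= setCK.
by have [y []] := clx _ _ FU xU.
Qed.

(** * Real and imaginary parts, supremum norm *)

Section Functions.
Context {R : realType} {X : topologicalType}.
Implicit Types f g : C(X; R).

Definition rfun (h : X -> R) (hc : continuous h) : C(X; R).
Proof.
refine (@mkcts X R[i]^o (fun x => (h x)%:C) _).
move=> x; apply: (@continuous_comp _ _ _ h (fun r : R => r%:C : R[i]^o)).
  exact: hc.
exact: continuous_realC.
Defined.

Definition fre f (x : X) : R := complex.Re (f x : R[i]).
Definition fim f (x : X) : R := complex.Im (f x : R[i]).

Lemma continuous_fre f : continuous (fre f).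
Proof.
move=> x; apply: (@continuous_comp _ _ _ f (fun z : R[i]^o => complex.Re (z : R[i]))).
  exact: cts_fun.
exact: continuous_Re.
Qed.

Lemma continuous_fim f : continuous (fim f).
Proof.
move=> x; apply: (@continuous_comp _ _ _ f (fun z : R[i]^o => complex.Im (z : R[i]))).
  exact: cts_fun.
exact: continuous_Im.
Qed.

Lemma cfunP f g : (forall x, f x = g x) -> f = g.
Proof. by move=> fg; apply/val_inj/funext. Qed.

Lemma cfun0E x : (0 : C(X; R)) x = 0. Proof. by []. Qed.
Lemma cfun1E x : (1 : C(X; R)) x = 1. Proof. by []. Qed.
Lemma cfunDE f g x : (f + g) x = f x + g x. Proof. by []. Qed.
Lemma cfunNE f x : (- f) x = - f x. Proof. by []. Qed.
Lemma cfunME f g x : (f * g) x = (f x : R[i]) * g x. Proof. by []. Qed.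
Lemma cfunZE (a : R[i]) f x : (a *: f) x = a * (f x : R[i]). Proof. by []. Qed.
Lemma cconjE f x : cconj f x = Num.conj (f x : R[i]). Proof. by []. Qed.
Definition cfunE := (cfun0E, cfun1E, cfunDE, cfunNE, cfunME, cfunZE, cconjE).

Lemma rfunE (h : X -> R) (hc : continuous h) x : rfun hc x = (h x)%:C.
Proof. by []. Qed.

Lemma freD f g x : fre (f + g) x = fre f x + fre g x.
Proof. by rewrite /fre cfunE; case: (f x : R[i]) (g x : R[i]) => ? ? []. Qed.

Lemma freN f x : fre (- f) x = - fre f x.
Proof. by rewrite /fre cfunE; case: (f x : R[i]). Qed.

Lemma freB f g x : fre (f - g) x = fre f x - fre g x.
Proof. by rewrite freD freN. Qed.

Lemma freZ (r : R) f x : fre (r%:C *: f) x = r * fre f x.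
Proof. by rewrite /fre cfunE; case: (f x : R[i]) => a b /=; rewrite mul0r subr0. Qed.

Lemma cfun_re_im f :
  f = rfun (@continuous_fre f) + 'i%C *: rfun (@continuous_fim f).
Proof. by apply: cfunP => x; rewrite !cfunE !rfunE -complexE. Qed.

Context (X_compact : compact [set: X]).

Lemma cfun_bounded f : exists B : R, forall x, rnorm (f x) <= B.
Proof.
pose P (U : set X) := exists B : R, forall x, U x -> rnorm (f x) <= B.
suff [B hB] : P setT by exists B => x; apply: hB.
apply: compact_induction => //.
- by exists 0.
- by move=> A B AB [b hb]; exists b => x /AB; exact: hb.
- move=> A B [a ha] [b hb]; exists (Num.max a b) => x [/ha|/hb] h.
    by rewrite le_max h.
  by rewrite le_max h orbT.
- move=> x; have fx : f @ x --> f x by exact: cts_fun.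
  have h := (@cvg_rnormP R R[i]^o _ (nbhs x) _ f (f x)).1 fx _ ltr01.
  exists [set y | rnorm (f x - f y) < 1]; first exact: h.
  exists (rnorm (f x) + 1) => y /= hy.
  rewrite -[f y](subrK (f x)) addrC; apply: le_trans (rnormD _ _) _.
  by rewrite lerD2l -rnormN opprB ltW.
Qed.

Lemma has_ubound_supnorm f : has_ubound [set rnorm (f x) | x in [set: X]].
Proof. by have [B hB] := cfun_bounded f; exists B => _ [x _ <-]. Qed.

Lemma le_supnorm f x : rnorm (f x) <= supnorm f.
Proof. by apply: ub_le_sup; [exact: has_ubound_supnorm | exists x]. Qed.

Lemma supnorm_le f (e : R) : 0 <= e -> (forall x, rnorm (f x) <= e) -> supnorm f <= e.
Proof.
move=> e0 fe; have [[x0 _]|nx] := pselect (exists x : X, True).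
  by apply: ge_sup; [exists (rnorm (f x0)), x0 | move=> _ [x _ <-]].
(* For empty [X] the supremum is over the empty set, where [sup] is 0. *)
rewrite /supnorm (_ : [set _ | _ in _] = set0) ?sup0 //.
by rewrite -subset0 => ? [x _ _]; apply: nx; exists x.
Qed.

Lemma supnorm_ge0 f : 0 <= supnorm f.
Proof.
have [[x _]|nx] := pselect (exists x : X, True).
  exact: le_trans (rnorm_ge0 (f x)) (le_supnorm f x).
rewrite /supnorm (_ : [set _ | _ in _] = set0) ?sup0 //.
by rewrite -subset0 => ? [x _ _]; apply: nx; exists x.
Qed.

Lemma ler_fre_supnorm f x : `|fre f x| <= supnorm f.
Proof. exact: le_trans (rnorm_Re _) (le_supnorm f x). Qed.

End Functions.

(** * The Hahn-Banach theorem *)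

Section HahnBanach.
Context {R : realType} {V : lmodType R[i]}.
Implicit Types (p q : V -> R) (v w : V).

(** Sublinearity is meant over the reals although [V] is complex: only the scalars [r%:C] with
    [r >= 0] occur. *)
Definition sublinear p := (forall v w, p (v + w) <= p v + p w) /\
  (forall (r : R) v, 0 <= r -> p (r%:C *: v) <= r * p v).

Lemma sublinear0 p : sublinear p -> p 0 = 0.
Proof.
move=> [pD pZ]; apply/eqP; rewrite eq_le; apply/andP; split.
  by have := pZ 0 0 (lexx 0); rewrite scaler0 mul0r.
by have := pD 0 0; rewrite addr0; lra.
Qed.

Lemma sublinearZ p (r : R) v : sublinear p -> 0 <= r -> p (r%:C *: v) = r * p v.
Proof.
move=> sp r0; apply/eqP; rewrite eq_le sp.2 //=.
have [->|r_neq0] := eqVneq r 0; first by rewrite mul0r scale0r sublinear0.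
have {}r0 : 0 < r by rewrite lt_def r_neq0.
rewrite mulrC -ler_pdivlMr // mulrC.
have := sp.2 r^-1 (r%:C *: v); rewrite invr_ge0 (ltW r0) scalerA -rmorphM /=.
by rewrite mulVf ?gt_eqF // scale1r; exact.
Qed.

Lemma sublinearN p v : sublinear p -> - p (- v) <= p v.
Proof.
move=> sp; have := sp.1 v (- v); rewrite subrr sublinear0 //; lra.
Qed.

(** The members of [A] need not be sublinear one by one: it suffices that each sum or nonnegative
    multiple is dominated by some member. This covers both the translates of one functional and the
    chains in Zorn's lemma. *)
Lemma sublinear_inf (A : set (V -> R)) (b : V -> R) : A !=set0 ->
  (forall p v, A p -> b v <= p v) ->
  (forall p q v w, A p -> A q ->
    exists2 s, A s & s (v + w) <= p v + q w) ->
  (forall p (r : R) v, A p -> 0 <= r ->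
    exists2 s, A s & s (r%:C *: v) <= r * p v) ->
  exists q, [/\ sublinear q, forall p v, A p -> q v <= p v
    & forall v c, (forall p, A p -> c <= p v) -> c <= q v].
Proof.
move=> [p0 Ap0] Ab AD AZ; pose q v := inf [set p v | p in A].
have inf_lb v : has_lbound [set p v | p in A].
  by exists (b v) => _ [p Ap <-]; exact: Ab.
have qle p v : A p -> q v <= p v.
  by move=> Ap; apply: ge_inf; [exact: inf_lb | exists p].
have le_q v c : (forall p, A p -> c <= p v) -> c <= q v.
  move=> h; apply: lb_le_inf; first by exists (p0 v), p0.
  by move=> _ [p Ap <-]; exact: h.
exists q; split=> //; split=> [v w|r v r0].
  rewrite -lerBlDr; apply: (le_q) => p Ap; rewrite lerBlDr -lerBlDl.
  apply: (le_q) => s As; rewrite lerBlDl.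
  have [t At tp] := AD p s v w Ap As.
  exact: le_trans (qle _ _ At) tp.
have [r0'|r_gt0] := leP r 0.
  have -> : r = 0 by apply/eqP; rewrite eq_le r0 r0'.
  have [t At] := AZ p0 0 v Ap0 (lexx 0); rewrite !mul0r.
  exact: le_trans (qle _ _ At).
rewrite mulrC -ler_pdivrMr //; apply: (le_q) => p Ap; rewrite ler_pdivrMr // mulrC.
have [t At tp] := AZ p r v Ap r0.
exact: le_trans (qle _ _ At) tp.
Qed.

(** Take the infimum over [t >= 0] of [p (w + t v) - t p v], which is at least [- p (- w)]. The two
    bounds are the terms [t = 0] and [t = 1]. *)
Lemma sublinear_translate p v : sublinear p ->
  exists q, [/\ sublinear q, forall w, q w <= p w
    & forall w, q w <= p (w + v) - p v].
Proof.
move=> sp.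
pose A := [set s | exists2 t : R, 0 <= t &
  s = fun w => p (w + t%:C *: v) - t * p v].
have A0 : A p.
  exists 0 => //; apply/funext => w.
  by rewrite scale0r addr0 mul0r subr0.
have [||||q [sq qA Aq]] := @sublinear_inf A (fun w => - p (- w)).
- by exists p.
- move=> _ w [t t0 ->] /=; have := sp.1 (w + t%:C *: v) (- w).
  by rewrite addrC addKr sublinearZ //; lra.
- move=> _ _ w1 w2 [t t0 ->] [s s0 ->].
  exists (fun w => p (w + (t + s)%:C *: v) - (t + s) * p v).
    by exists (t + s) => //; exact: addr_ge0.
  have := sp.1 (w1 + t%:C *: v) (w2 + s%:C *: v).
  by rewrite addrACA -scalerDl -rmorphD /=; lra.
- move=> _ r w [t t0 ->] r0.
  exists (fun w => p (w + (r * t)%:C *: v) - (r * t) * p v).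
    by exists (r * t) => //; exact: mulr_ge0.
  have := sp.2 r (w + t%:C *: v) r0.
  by rewrite scalerDr scalerA -rmorphM /= mulrBr mulrA; lra.
exists q; split=> // [w|w]; first exact: qA.
apply: (qA (fun w => p (w + v) - p v)).
by exists 1 => //; apply/funext => u; rewrite scale1r mul1r.
Qed.

(** Zorn's lemma for the reversed pointwise order. The infimum of a chain exists because every
    sublinear [s <= p] satisfies [s w >= - p (- w)]. *)
Lemma sublinear_minimal p : sublinear p ->
  exists q, [/\ sublinear q, forall v, q v <= p v
    & forall s, sublinear s -> (forall v, s v <= q v) -> s = q].
Proof.
move=> sp; pose T := {q | sublinear q /\ forall v, q v <= p v}.
pose le (s t : T) : bool := `[< forall v, sval t v <= sval s v >].
have [||||[q [sq qp]] qmin] := @Zorn T le.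
- by move=> t; apply/asboolP => v.
- move=> r s t /asboolP rs /asboolP st; apply/asboolP => v.
  exact: le_trans (st v) (rs v).
- move=> [s hs] [t ht] /asboolP /= st /asboolP /= ts.
  by apply: eq_exist; apply/funext => v; apply/eqP; rewrite eq_le st ts.
- move=> A Atot; have [[t0 At0]|nA] := pselect (exists t, A t); last first.
    exists (exist _ p (conj sp (fun v => lexx _))) => s As.
    by exfalso; apply: nA; exists s.
  have [||||q [sq qA Aq]] :=
      @sublinear_inf [set sval t | t in A] (fun w => - p (- w)).
  + by exists (sval t0), t0.
  + move=> _ v [[s [ss sp']] _ <-] /=.
    by apply: le_trans (sublinearN _ ss); rewrite lerN2.
  + move=> _ _ v w [s As <-] [t At <-].
    have [/asboolP st|/asboolP ts] := Atot s t As At.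
      exists (sval t); first by exists t.
      by have := (svalP t).1.1 v w; have := st v; lra.
    exists (sval s); first by exists s.
    by have := (svalP s).1.1 v w; have := ts w; lra.
  + move=> _ r v [s As <-] r0; exists (sval s); first by exists s.
    exact: (svalP s).1.2.
  have qp v : q v <= p v.
    by apply: le_trans ((svalP t0).2 v); apply: qA; exists t0.
  exists (exist _ q (conj sq qp)) => s As.
  by apply/asboolP => v /=; apply: qA; exists s.
exists q; split=> // s ss sq'.
have sp' v : s v <= p v by exact: le_trans (sq' v) (qp v).
have := qmin (exist _ s (conj ss sp')).
have h : le (exist _ q (conj sq qp)) (exist _ s (conj ss sp')) by exact/asboolP.
by move/(_ h) => [].
Qed.

(* A minimal sublinear functional is additive: it coincides with each of its
   translates in the sense of [sublinear_translate]. *)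
Theorem Hahn_Banach p v0 : sublinear p ->
  exists L : V -> R, [/\ forall v w, L (v + w) = L v + L w,
    forall (r : R) v, L (r%:C *: v) = r * L v,
    forall v, L v <= p v & L v0 = p v0].
Proof.
(* Minimising below [p'] instead of [p] fixes the value at [v0]: since
   [p' (- v0) <= p 0 - p v0 = - p v0], every additive [q <= p'] has [q v0 >= p v0]. *)
move=> sp; have [p' [sp' p'p p't]] := sublinear_translate v0 sp.
have [q [sq qp' qmin]] := sublinear_minimal sp'.
have qD v w : q (v + w) = q v + q w.
  apply/eqP; rewrite eq_le sq.1 /=.
  have [s [ss sq' st]] := sublinear_translate w sq.
  by have := st v; rewrite (qmin s ss sq'); lra.
have qN v : q (- v) = - q v.
  by have := qD v (- v); rewrite subrr sublinear0 //; lra.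
have qp v : q v <= p v by exact: le_trans (qp' v) (p'p v).
exists q; split=> // [r v|].
  have [r0|/ltW r0] := leP 0 r; first exact: sublinearZ.
  rewrite -[r]opprK rmorphN scaleNr qN sublinearZ ?oppr_ge0 //; lra.
apply/eqP; rewrite eq_le qp /=.
have := le_trans (qp' (- v0)) (p't (- v0)).
by rewrite qN addNr sublinear0 //; lra.
Qed.

End HahnBanach.

(** * States and Choquet points *)

Section Complexification.
Context {R : realType} {V : lmodType R[i]}.

(** [F] is the complex-linear functional whose real part is the given real-linear [L]. *)
Lemma complexify_linear (L : V -> R) :
  (forall v w, L (v + w) = L v + L w) ->
  (forall (r : R) v, L (r%:C *: v) = r * L v) ->
  forall (a : R[i]) v w, let F u := L u -i* L ('i%C *: u) in
    F (a *: v + w) = a * F v + F w.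
Proof.
move=> LD LZ [a1 a2] v w /=.
have LN u : L (- u) = - L u.
  by rewrite -scaleN1r -(rmorphN1 (real_complex R)) LZ mulN1r.
have aE : a1 +i* a2 = a1%:C + a2%:C * 'i%C by simpc.
rewrite scalerDr !LD scalerA aE.
have -> : 'i%C * (a1%:C + a2%:C * 'i%C) = a1%:C * 'i%C + (- a2)%:C :> R[i].
  by simpc.
rewrite !scalerDl !LD -!scalerA !LZ; simpc; congr (_ +i* _); ring.
Qed.

End Complexification.

Section States.
Context {R : realType} {X : topologicalType}.
Implicit Types (f g : C(X; R)) (phi : C(X; R) -> R[i]).

Lemma fre_i f x : fre ('i%C *: f) x = - fim f x.
Proof.
rewrite /fre /fim cfunE; case: (f x : R[i]) => a b /=.
by rewrite mul0r mul1r sub0r.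
Qed.

(** On a compact Hausdorff space these are, by Riesz, the integrals against Radon probability
    measures; the arguments below use the functionals directly. *)
Definition state phi : Prop :=
  [/\ forall a f g, phi (a *: f + g) = a * phi f + phi g, phi 1 = 1
    & forall f, (forall x, 0 <= (f x : R[i])) -> 0 <= phi f].

Lemma eval_state (x : X) : state (fun f => f x).
Proof. by split=> // f; exact. Qed.

Context phi (phi_state : state phi).

Lemma stateD f g : phi (f + g) = phi f + phi g.
Proof. by case: phi_state => h _ _; have := h 1 f g; rewrite scale1r mul1r. Qed.

Lemma state0 : phi 0 = 0.
Proof. by apply: (addrI (phi 0)); rewrite -stateD !addr0. Qed.

Lemma stateZ a f : phi (a *: f) = a * phi f.
Proof. by case: phi_state => h _ _; have := h a f 0; rewrite state0 !addr0. Qed.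

Lemma stateN f : phi (- f) = - phi f.
Proof. by rewrite -scaleN1r stateZ mulN1r. Qed.

Lemma stateB f g : phi (f - g) = phi f - phi g.
Proof. by rewrite stateD stateN. Qed.

Lemma state_const a : phi (a *: (1 : C(X; R))) = a.
Proof. by rewrite stateZ; case: phi_state => _ -> _; rewrite mulr1. Qed.

Context (X_compact : compact [set: X]).

(** [h] is the difference of the nonnegative functions [B] and [B - h], on which [phi] is
    nonnegative. *)
Lemma state_rfun (h : X -> R) (hc : continuous h) :
  phi (rfun hc) = (complex.Re (phi (rfun hc)))%:C.
Proof.
have [_ _ pos] := phi_state; pose B := supnorm (rfun hc).
have hB : 0 <= phi (B%:C *: (1 : C(X; R)) - rfun hc).
  apply: pos => x; rewrite !cfunE mulr1 rfunE subr_ge0 lecR.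
  by apply: le_trans (ler_fre_supnorm X_compact (rfun hc) x); exact: ler_norm.
have BB : 0 <= phi (B%:C *: (1 : C(X; R))).
  by apply: pos => x; rewrite !cfunE mulr1 ler0c; exact: supnorm_ge0.
have -> : phi (rfun hc) =
    phi (B%:C *: (1 : C(X; R))) - phi (B%:C *: (1 : C(X; R)) - rfun hc).
  by rewrite -stateB subKr.
by rewrite (ger0_complexE hB) (ger0_complexE BB) -rmorphB.
Qed.

Lemma state_re f :
  complex.Re (phi f) = complex.Re (phi (rfun (@continuous_fre _ _ f))).
Proof.
rewrite {1}(cfun_re_im f) stateD stateZ (state_rfun (@continuous_fim _ _ f)).
by rewrite (state_rfun (@continuous_fre _ _ f)); simpc.
Qed.

Lemma state_le f g : (forall x, fre f x <= fre g x) ->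
  complex.Re (phi f) <= complex.Re (phi g).
Proof.
have [_ _ pos] := phi_state; move=> fg.
rewrite (state_re f) (state_re g) -lecR -!state_rfun -subr_ge0 -stateB.
by apply: pos => x; rewrite !cfunE !rfunE subr_ge0 lecR.
Qed.

End States.

(** * Majorants in M at a Choquet point *)

Section Choquet.
Context {R : realType} {X : topologicalType} (X_compact : compact [set: X]).
Context (M : set C(X; R)) (M_space : unital_function_space M).
Implicit Types (f g : C(X; R)) (phi : C(X; R) -> R[i]).

Definition choquet (x : X) : Prop :=
  forall phi, state phi -> (forall g, M g -> phi g = g x) ->
    forall f, phi f = f x.

Lemma space0 : M 0.
Proof.
have [M1 Mlin] := M_space.
by rewrite -(addNr 1) -scaleN1r; exact: Mlin.
Qed.

Lemma spaceZ a g : M g -> M (a *: g).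
Proof. by move=> Mg; rewrite -[_ *: _]addr0; apply: M_space.2 => //; exact: space0. Qed.

Lemma spaceD f g : M f -> M g -> M (f + g).
Proof. by move=> Mf Mg; rewrite -[f]scale1r; exact: M_space.2. Qed.

(** Let [p h] be the infimum of [fre g x] over the [g] in [M] whose real part majorises that of [h].
    A functional [L <= p] with [L f = p f] complexifies to a state that agrees on [M] with
    evaluation at [x]. Hence [p f = fre f x], and some majorant comes within [e] of the infimum. *)
Lemma choquet_majorant x f (e : R) : choquet x -> 0 < e ->
  exists g, [/\ M g, forall y, fre f y <= fre g y & fre g x < fre f x + e].
Proof.
move=> xCh e0.
pose A f := [set g | M g /\ forall y, fre f y <= fre g y].
pose p f := inf [set fre g x | g in A f].
have A0 h : A h ((supnorm h)%:C *: (1 : C(X; R))).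
  split; first by apply: spaceZ; exact: M_space.1.
  move=> y; rewrite freZ mulr1.
  exact: le_trans (ler_norm _) (ler_fre_supnorm X_compact h y).
have lbA h : has_lbound [set fre g x | g in A h].
  by exists (fre h x) => _ [g [_ gh] <-].
have ple h g : A h g -> p h <= fre g x.
  by move=> Ag; apply: ge_inf => //; exists g.
have lep h c : (forall g, A h g -> c <= fre g x) -> c <= p h.
  move=> hc; apply: lb_le_inf.
    by exists (fre ((supnorm h)%:C *: (1 : C(X; R))) x), ((supnorm h)%:C *: (1 : C(X; R))).
  by move=> _ [g Ag <-]; exact: hc.
have sp : sublinear p.
  split=> [h1 h2|r h r0].
    rewrite -lerBlDr; apply: (lep) => g1 Ag1; rewrite lerBlDr -lerBlDl.
    apply: (lep) => g2 Ag2; rewrite lerBlDl -freD; apply: (ple).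
    split=> [|y]; first by apply: spaceD; [exact: Ag1.1|exact: Ag2.1].
    by rewrite !freD lerD //; [exact: Ag1.2|exact: Ag2.2].
  have [r0'|r_gt0] := leP r 0.
    have -> : r = 0 by apply/eqP; rewrite eq_le r0 r0'.
    rewrite mul0r scale0r; have := ple 0 0; apply.
    by split=> [|y]; [exact: space0|].
  rewrite mulrC -ler_pdivrMr //; apply: (lep) => g Ag.
  rewrite ler_pdivrMr // mulrC -freZ; apply: (ple); split=> [|y].
    by apply: spaceZ; exact: Ag.1.
  by rewrite !freZ ler_wpM2l //; exact: Ag.2.
have [L [LD LZ Lp Lf]] := Hahn_Banach f sp.
have LN h : L (- h) = - L h.
  by rewrite -scaleN1r -(rmorphN1 (real_complex R)) LZ mulN1r.
pose phi h : R[i] := L h -i* L ('i%C *: h).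
(* Here 0 is a majorant of [h]; this is what makes [phi] positive. *)
have Lle h : (forall y, fre h y <= 0) -> L h <= 0.
  by move=> h0; apply: le_trans (Lp _) _; apply: (ple h 0); split=> //; exact: space0.
have LM g : M g -> L g = fre g x.
  move=> Mg; apply/eqP; rewrite eq_le; apply/andP; split.
    by apply: le_trans (Lp _) _; apply: ple; split.
  rewrite -lerN2 -LN -freN; apply: le_trans (Lp _) _; apply: ple.
  by split=> //; rewrite -scaleN1r; exact: spaceZ.
have phiM g : M g -> phi g = g x.
  move=> Mg; rewrite /phi !LM ?fre_i //; last exact: spaceZ.
  by rewrite opprK /fre /fim; case: (g x).
have phi_state : state phi.
  split; [exact: complexify_linear | by rewrite phiM //; exact: M_space.1 |].
  move=> h h0; rewrite lecE /=; apply/andP; split; last first.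
    rewrite -oppr_le0 -LN; apply: Lle => y; rewrite freN oppr_le0.
    by have := h0 y; rewrite lecE => /andP[].
  have hi y : fim h y = 0 by have := h0 y; rewrite lecE => /andP[/eqP].
  rewrite oppr_eq0 eq_le Lle /=; last by move=> y; rewrite fre_i hi oppr0 lexx.
  by rewrite -oppr_le0 -LN; apply: Lle => y; rewrite freN fre_i hi oppr0 oppr0 lexx.
have Lfx : L f = fre f x.
  by rewrite /fre -(xCh _ phi_state phiM f).
have /inf_adherent : has_inf [set fre g x | g in A f].
  split=> //.
  by exists (fre ((supnorm f)%:C *: (1 : C(X; R))) x), ((supnorm f)%:C *: (1 : C(X; R))).
move=> /(_ _ e0)[_ [g [Mg fg] <-] gx]; exists g; split=> //.
by rewrite -Lfx Lf.
Qed.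

End Choquet.

(** * Chains of closed sets in a compact space *)

Section Chains.
Context {X : topologicalType} (X_compact : compact [set: X]).

(** The induction runs over the sets [V] on which some member of the chain lies inside [U]. For a
    union of two such sets, the smaller of the two members serves. *)
Lemma chain_bigcap_open (A : set (set X)) (U : set X) :
  A !=set0 -> total_on A subset -> (forall E, A E -> closed E) -> open U ->
  \bigcap_(E in A) E `<=` U -> exists2 E, A E & E `<=` U.
Proof.
move=> [E0 AE0] Atot Acl oU AU.
pose P (V : set X) := exists2 E, A E & E `&` V `<=` U.
suff [E AE EU] : P setT by exists E => //; rewrite setIT in EU.
apply: compact_induction => //.
- by exists E0 => // x [].
- by move=> V W VW [E AE EW]; exists E => // x [Ex /VW Wx]; exact: EW.
- move=> V W [E AE EV] [F AF FW]; have [EF|FE] := Atot E F AE AF.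
    by exists E => // x [Ex [Vx|Wx]]; [exact: EV | apply: FW; split=> //; exact: EF].
  by exists F => // x [Fx [Vx|Wx]]; [apply: EV; split=> //; exact: FE | exact: FW].
- move=> x; have [Ux|nUx] := pselect (U x).
    by exists U; [exact: open_nbhs_nbhs | exists E0 => // y []].
  have [E [AE nEx]] : exists E, A E /\ ~ E x.
    apply: contrapT => h; apply/nUx/AU => E AE.
    by apply: contrapT => nEx; apply: h; exists E.
  exists (~` E); last by exists E => // y [].
  by apply: open_nbhs_nbhs; split=> //; apply: closed_openC; exact: Acl.
Qed.

Lemma chain_bigcap_neq0 (A : set (set X)) :
  A !=set0 -> total_on A subset -> (forall E, A E -> closed E) ->
  (forall E, A E -> E !=set0) -> \bigcap_(E in A) E !=set0.
Proof.
move=> A0 Atot Acl Ane; apply/set0P/negP => /eqP h.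
have [|E AE] := chain_bigcap_open A0 Atot Acl open0; first by rewrite h.
by have [x Ex] := Ane _ AE; move/(_ x Ex).
Qed.

End Chains.

(** * Existence of Choquet points *)

Section ChoquetExistence.
Context {R : realType} {X : topologicalType} (X_compact : compact [set: X]).
Context (M : set C(X; R)) (M_space : unital_function_space M).
Implicit Types (f g : C(X; R)) (phi : C(X; R) -> R[i]) (E : set X).

(* For the probability measures mu representing a point of E on M, this says
   that mu is carried by E. *)
Definition stable E : Prop := [/\ closed E, E !=set0
  & forall x phi, E x -> state phi -> (forall g, M g -> phi g = g x) ->
    forall f (c : R), (forall y, E y -> fre f y <= c) -> complex.Re (phi f) <= c].

Lemma stableT : [set: X] !=set0 -> stable [set: X].
Proof.
split=> // x phi _ sphi _ f c fc.
have -> : c = complex.Re (phi (c%:C *: (1 : C(X; R)))) by rewrite state_const.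
by apply: state_le => // y; rewrite freZ mulr1; exact: fc.
Qed.

Lemma closed_fre_ge f (c : R) : closed [set y | c <= fre f y].
Proof.
apply: (@preimage_closed _ _ (fre f) [set r | c <= r]); last exact: closed_ge.
by move=> x _; exact: continuous_fre.
Qed.

(** A measure carried by [E] whose integral of [fre g] equals the maximum of [fre g] over [E] must
    be carried by the set where this maximum is attained. *)
Lemma stable_face E g : stable E -> M g ->
  stable [set x | E x /\ forall y, E y -> fre g y <= fre g x].
Proof.
move=> [cE E0 Est] Mg.
(* The face is the intersection of a chain of nonempty closed superlevel sets, so it is closed and
   the maximum is attained. *)
pose A := [set [set z | E z /\ fre g y <= fre g z] | y in E].
have AE : [set x | E x /\ forall y, E y -> fre g y <= fre g x] = \bigcap_(F in A) F.
  apply/seteqP; split=> [x [Ex gx] _ [y Ey <-]|x Ax]; first by split=> //; exact: gx.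
  split=> [|y Ey]; last by have [] := Ax _ (ex_intro2 _ _ y Ey erefl).
  by case: E0 => y Ey; have [] := Ax _ (ex_intro2 _ _ y Ey erefl).
have Acl F : A F -> closed F.
  by move=> [y Ey <-]; apply: closedI => //; exact: closed_fre_ge.
split.
- by rewrite AE; exact: closed_bigI.
- rewrite AE; apply: chain_bigcap_neq0 => //.
  + by case: E0 => y Ey; eexists; exists y.
  + move=> _ _ [y Ey <-] [z Ez <-].
    by have [yz|/ltW zy] := leP (fre g y) (fre g z); [right|left] => w [Ew];
      split=> //; [exact: le_trans yz _ | exact: le_trans zy _].
  + by move=> _ [y Ey <-]; exists y.
move=> x phi [Ex gx] sphi phiM f c fc.
suff {}H (e : R) : 0 < e -> complex.Re (phi f) <= c + e.
  by apply/ler_addgt0Pr => e; exact: H.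
move=> e0.
(* phi (K (g x - g)) = 0, and f <= c + e + K (g x - g) on E for large K *)
pose h (K : nat) := f + K%:R%:C *: g.
pose W K := [set z | E z /\ c + e + K%:R * fre g x <= fre (h K) z].
have hE K z : fre (h K) z = fre f z + K%:R * fre g z by rewrite freD freZ.
(* The sets [W K] decrease, as [fre g z <= fre g x] on [E]. If all were nonempty they would share a
   point [z]. Either [z] lies in the face, where [fre f z <= c] contradicts [K = 0], or
   [fre g z < fre g x], which a large [K] contradicts. *)
have [K WK] : exists K, W K = set0.
  apply: contrapT => nW; have : \bigcap_(F in range W) F !=set0.
    apply: chain_bigcap_neq0 => //.
    + by exists (W 0%N), 0%N.
    + have Wle m n : (m <= n)%N -> W n `<=` W m.
        move=> mn z [Ez]; rewrite hE => hz; split=> //; rewrite hE.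
        have mn' : m%:R <= n%:R :> R by rewrite ler_nat.
        by have := gx z Ez; nra.
      move=> _ _ [m _ <-] [n _ <-].
      by have [mn|/ltnW mn] := leqP m n; [right|left]; exact: Wle mn.
    + by move=> _ [K _ <-]; apply: closedI => //; exact: closed_fre_ge.
    + by move=> _ [K _ <-]; apply/set0P/negP => /eqP WK; apply: nW; exists K.
  move=> [z Wz]; have WzK K : W K z by apply: Wz; exists K.
  have [Ez] := WzK 0%N; rewrite hE !mul0r !addr0 => fz.
  have := gx z Ez; rewrite le_eqVlt => /orP[/eqP gz|gz].
    have : fre f z <= c by apply: fc; split=> // y Ey; rewrite gz; exact: gx.
    lra.
  pose K := Num.truncn ((fre f z - c) / (fre g x - fre g z)).
  have := truncnS_gt ((fre f z - c) / (fre g x - fre g z)).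
  rewrite -/K ltr_pdivrMr ?subr_gt0 // => hK.
  have [_] := WzK K.+1; rewrite hE; lra.
have : complex.Re (phi (h K)) <= c + e + K%:R * fre g x.
  apply: (Est x) => // y Ey; rewrite leNgt; apply/negP => /ltW yW.
  by have : W K y by []; rewrite WK.
rewrite /h stateD // stateZ // (phiM g) // /fre.
by case: (phi f) (g x : R[i]) => a b [a' b'] /=; lra.
Qed.

(** Zorn's lemma for reversed inclusion. The intersection of a chain is stable: a bound [fre f <= c]
    on it becomes, by compactness, [fre f < c + e] on some member of the chain. *)
Lemma stable_minimal E : stable E ->
  exists F, [/\ stable F, F `<=` E & forall G, stable G -> G `<=` F -> G = F].
Proof.
move=> sE; pose T := {F | stable F /\ F `<=` E}.
pose le (s t : T) : bool := `[< sval t `<=` sval s >].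
have [||||[F [sF FE]] Fmin] := @Zorn T le.
- by move=> t; apply/asboolP.
- by move=> r s t /asboolP rs /asboolP st; apply/asboolP; exact: subset_trans st rs.
- move=> [s hs] [t ht] /asboolP /= st /asboolP /= ts.
  by apply: eq_exist; exact/seteqP.
- move=> A Atot; have [[t0 At0]|nA] := pselect (exists t, A t); last first.
    exists (exist _ E (conj sE (@subset_refl _ _))) => s As.
    by exfalso; apply: nA; exists s.
  pose B := [set sval t | t in A].
  have B0 : B !=set0 by exists (sval t0), t0.
  have Btot : total_on B subset.
    move=> _ _ [s As <-] [t At <-].
    by have [/asboolP|/asboolP] := Atot s t As At; [right|left].
  have Bcl F : B F -> closed F by move=> [s _ <-]; case: (svalP s) => -[].
  have sB : stable (\bigcap_(F in B) F).
    split; first exact: closed_bigI.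
      by apply: chain_bigcap_neq0 => // _ [s _ <-]; case: (svalP s) => -[].
    move=> x phi Bx sphi phiM f c fc; apply/ler_addgt0Pr => e e0.
    have [||F BF Fc] := @chain_bigcap_open _ X_compact B
        [set y | fre f y < c + e] B0 Btot Bcl.
    + rewrite (_ : [set _ | _] = ~` [set y | c + e <= fre f y]).
        by apply: closed_openC; exact: closed_fre_ge.
      by apply/seteqP; split=> y /=; rewrite leNgt; [move=> ->|move/negP; rewrite negbK].
    + by move=> y By /=; have := fc y By; lra.
    have [_ _ sF] : stable F by case: BF => s _ <-; case: (svalP s).
    apply: sF sphi phiM _ _ _; first exact: Bx.
    by move=> y /Fc /ltW.
  have BE : \bigcap_(F in B) F `<=` E.
    by move=> x Bx; apply: (svalP t0).2; apply: Bx; exists t0.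
  exists (exist _ (\bigcap_(F in B) F) (conj sB BE)) => s As; apply/asboolP => x /= Bx.
  by apply: Bx; exists s.
exists F; split=> // G sG GF.
have GE : G `<=` E by exact: subset_trans GF FE.
have h : le (exist _ F (conj sF FE)) (exist _ G (conj sG GE)) by exact/asboolP.
by have := Fmin _ h => -[].
Qed.

(** A minimal stable set [E] inside the face where [fre g] is maximal equals each of its own faces,
    so every function of [M] has constant real part on [E]. As [M] separates points, [E] is a single
    point [y], and stability of that point is the Choquet property. *)
Lemma choquet_max (g : C(X; R)) (x : X) :
  (forall y z, (forall h, M h -> h y = h z) -> y = z) -> M g ->
  exists2 y, choquet M y & fre g x <= fre g y.
Proof.
move=> Msep Mg; have sT : stable [set: X] by apply: stableT; exists x.
have [E [sE Eg Emin]] := stable_minimal (stable_face sT Mg).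
have [cE [y Ey] Est] := sE.
have Ere h z : M h -> E z -> fre h z = fre h y.
  move=> Mh Ez; have := Emin _ (stable_face sE Mh) => /(_ (fun _ => @proj1 _ _)) EE.
  move: (Ez) (Ey); rewrite -EE => -[_ hz] [_ hy].
  by apply/eqP; rewrite eq_le hz // hy.
have E1 z : E z -> z = y.
  move=> Ez; apply: Msep => h Mh.
  (* The real part of [i h] supplies the imaginary part of [h]. *)
  have := Ere _ z (spaceZ M_space 'i%C Mh) Ez; have := Ere _ z Mh Ez.
  rewrite !fre_i /fre /fim; case: (h z : R[i]) (h y : R[i]) => a b [a' b'] /=.
  by move=> -> /oppr_inj ->.
exists y; last by have [_] := Eg y Ey; apply.
move=> phi sphi phiM.
have phi_le f : complex.Re (phi f) <= fre f y.
  by apply: Est sphi phiM _ _ _ => // z /E1 ->.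
have phi_re f : complex.Re (phi f) = fre f y.
  apply/eqP; rewrite eq_le phi_le /= -lerN2 -freN.
  by have := phi_le (- f); rewrite stateN //; case: (phi f).
move=> f; have := phi_re f; have := phi_re ('i%C *: f).
rewrite fre_i stateZ // /fre /fim; case: (phi f) (f y : R[i]) => a b [a' b'] /=.
by rewrite mul0r mul1r sub0r => /oppr_inj -> ->.
Qed.

End ChoquetExistence.

(** * The Hilbert space l2(I) *)

Section UnorderedSums.
Context {R : realType} {I : choiceType}.
Implicit Types (u v : I -> R[i]) (A B : {fset I}).

(** Unconditional summation: the limit is along the finite subsets of [I], which may be
    uncountable. *)
Definition is_hsum u (l : R[i]) : Prop :=
  (fun A => \sum_(i <- A) u i : R[i]^o) @ totally --> (l : R[i]^o).

Lemma is_hsum_unique u (l l' : R[i]) : is_hsum u l -> is_hsum u l' -> l = l'.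
Proof. by move=> h h'; exact: (@norm_cvg_unique _ R[i]^o _ _ _ _ h h'). Qed.

Lemma is_hsumD u v (l l' : R[i]) : is_hsum u l -> is_hsum v l' ->
  is_hsum (fun i => u i + v i) (l + l').
Proof.
move=> hu hv; rewrite /is_hsum (_ : (fun A => _) =
  (fun A => \sum_(i <- A) u i : R[i]^o) \+ (fun A => \sum_(i <- A) v i : R[i]^o)).
  exact: (@cvgD R[i] R[i]^o _ _ _ _ _ _ _ hu hv).
by apply/funext => A; rewrite big_split.
Qed.

Lemma is_hsumZ (a : R[i]) u (l : R[i]) : is_hsum u l -> is_hsum (fun i => a * u i) (a * l).
Proof.
move=> hu; rewrite /is_hsum (_ : (fun A => _) =
  a \*: (fun A => \sum_(i <- A) u i : R[i]^o)).
  exact: (@cvgZl_tmp R[i] R[i]^o _ _ _ _ _ _ hu).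
by apply/funext => A; rewrite -mulr_sumr.
Qed.

Lemma is_hsum_conj u (l : R[i]) : is_hsum u l ->
  is_hsum (fun i => Num.conj (u i)) (Num.conj l).
Proof.
move=> /cvg_rnormP hu; apply/cvg_rnormP => e e0.
apply: filterS (hu e e0) => A; apply: le_lt_trans.
by rewrite -rmorph_sum -rmorphB /rnorm norm_conjC.
Qed.

Lemma cvg_ge0 (T : Type) (F : set_system T) {FF : ProperFilter F} (f : T -> R[i]^o)
    (l : R[i]^o) :
  f @ F --> l -> (\forall t \near F, 0 <= (f t : R[i])) -> 0 <= (l : R[i]).
Proof.
move=> /cvg_rnormP fl f0.
have h (e : R) : 0 < e -> exists t, 0 <= (f t : R[i]) /\ rnorm (l - f t) < e.
  by move=> e0; near F => t; exists t; split; near: t => //; exact: fl.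
rewrite lecE; apply/andP; split.
  rewrite /= -normr_le0; apply/ler_addgt0Pr => e e0; rewrite add0r.
  have [t [ft tl]] := h e e0; apply: le_trans (ltW tl).
  have := rnorm_Im (l - f t); rewrite (ger0_complexE ft).
  by case: (l) => a b /=; rewrite oppr0 addr0.
rewrite /= leNgt; apply/negP => l0.
have [|t [ft tl]] := h (- complex.Re (l : R[i])); first by rewrite oppr_gt0.
have := le_lt_trans (rnorm_Re (l - f t)) tl.
move: ft; rewrite lecE => /andP[_].
by case: (f t) (l) => a b [c d] /=; rewrite ltr_norml => a0 /andP[]; lra.
Unshelve. all: by end_near. Qed.

Lemma is_hsum_ge0 u (l : R[i]) : is_hsum u l ->
  (forall i, 0 <= u i) -> 0 <= l.
Proof.
by move=> hu u0; apply: cvg_ge0 hu _; apply: nearW => A; exact: sumr_ge0.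
Qed.

Lemma ler_fset_sum (h : I -> R) A B : (forall i, 0 <= h i) -> (A `<=` B)%fset ->
  \sum_(i <- A) h i <= \sum_(i <- B) h i.
Proof.
move=> h0 AB; rewrite [leRHS](big_fsetID _ (mem A)) /=.
rewrite (_ : [fset x in B | x \in A]%fset = A) ?lerDl ?sumr_ge0 //.
apply/fsetP => i; rewrite !inE /= andbC.
by case: (boolP (i \in A)) => //= /(fsubsetP AB).
Qed.

(** A sum of nonnegative terms is the supremum of its finite partial sums; the last two clauses
    characterise [s] as this supremum. *)
Lemma is_hsum_real (h : I -> R) (b : R) : (forall i, 0 <= h i) ->
  (forall A, \sum_(i <- A) h i <= b) ->
  exists2 s : R, is_hsum (fun i => (h i)%:C) s%:C &
    (forall A, \sum_(i <- A) h i <= s) /\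
    forall c, (forall A, \sum_(i <- A) h i <= c) -> s <= c.
Proof.
move=> h0 hb; pose S := [set \sum_(i <- A) h i | A in [set: {fset I}]].
have S0 : S !=set0 by exists (\sum_(i <- fset0) h i), fset0.
have Sb : has_ubound S by exists b => _ [A _ <-].
have leS A : \sum_(i <- A) h i <= sup S by apply: ub_le_sup => //; exists A.
exists (sup S); last first.
  by split=> // c hc; apply: ge_sup => // _ [A _ <-].
apply/cvg_rnormP => e e0.
have [_ [A _ <-] hA] := sup_adherent e0 (conj S0 Sb).
exists A => // B /= AB; rewrite -rmorph_sum -rmorphB rnormC.
by have := leS B; have := ler_fset_sum h0 AB; rewrite ltr_norml; lra.
Qed.

End UnorderedSums.

Arguments is_hsumZ {R I} a {u l} _.

(** * Cauchy-Schwarz and triangle inequalities *)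

Section DotNorm.
Context {R : realType} {U : lmodType R[i]} (form : {dot U for (@Num.conj R[i])}).
Implicit Types u v : U.

(** Expand the nonnegative square of [form v v *: u - form u v *: v] and divide by [form v v]. *)
Lemma dot_Cauchy_Schwarz u v : `|form u v| ^+ 2 <= form u u * form v v.
Proof.
have [->|v0] := eqVneq v 0; first by rewrite !linear0r normr0 expr0n mulr0.
have vv : 0 < form v v by exact: neq0_dnorm_gt0.
have : 0 <= form (form v v *: u - form u v *: v) (form v v *: u - form u v *: v).
  exact: dnorm_ge0.
have vvr : Num.conj (form v v) = form v v by apply/CrealP; exact: gtr0_real.
have uv : form v u = Num.conj (form u v).
  by have := @hermitian_subproof _ _ _ _ form v u; rewrite expr0 mul1r.
rewrite linearBl !linearBr !linearZl_LR !linearZr_LR /= vvr uv normCK.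
have -> : form v v * (form v v * form u u) -
  form v v * ((form u v)^* * form u v) -
  (form u v * (form v v * (form u v)^* ) -
  form u v * ((form u v)^* * form v v)) =
  form v v * (form u u * form v v - form u v * (form u v)^* ) by ring.
by rewrite pmulr_rge0 // subr_ge0.
Qed.

Lemma dot_triangle u v :
  sqrtC (form (u + v) (u + v)) <= sqrtC (form u u) + sqrtC (form v v).
Proof.
have p w : 0 <= form w w by exact: dnorm_ge0.
rewrite -ler_sqr ?nnegrE ?addr_ge0 ?sqrtC_ge0 // sqrrD !sqrtCK.
rewrite dnormD [leRHS]addrAC lerD2l -sqrtCM ?nnegrE // -mulr_natr.
have : form u v + (form u v)^* <= `|form u v| * 2.
  have := leif_Re_Creal (form u v); rewrite ReE => -[h _].
  by move: h; rewrite ler_pdivrMr.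
move/le_trans; apply; rewrite ler_wpM2r //.
rewrite -[leLHS]sqrCK // ler_sqrtC ?nnegrE ?exprn_ge0 ?mulr_ge0 //.
exact: dot_Cauchy_Schwarz.
Qed.

End DotNorm.

(** * Square-summable families *)

Section L2.
Context (R : realType) (I : choiceType).

Definition l2_pred : {pred I -> R[i]^o} :=
  mem [set a | exists b : R, forall A : {fset I}, \sum_(i <- A) rnorm (a i) ^+ 2 <= b].

Structure l2 := L2 { l2_fun :> I -> R[i]^o; _ : l2_fun \in l2_pred }.

HB.instance Definition _ := [isSub for l2_fun].
HB.instance Definition _ := [Choice of l2 by <:].

Lemma l2_submod_closed : submod_closed l2_pred.
Proof.
split=> [|a f g /set_mem[b fb] /set_mem[c gc]]; apply/mem_set.
  exists 0 => A; rewrite big1 // => i _.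
  by rewrite (_ : (0 : I -> R[i]^o) i = 0) // rnorm0 expr0n.
exists (2 * (rnorm (a : R[i]^o) ^+ 2 * b + c)) => A.
have le i : rnorm ((a *: f + g) i) ^+ 2 <=
    2 * (rnorm (a : R[i]^o) ^+ 2 * rnorm (f i) ^+ 2 + rnorm (g i) ^+ 2).
  rewrite -[(a *: f + g) i]/(a *: f i + g i).
  have := rnormD (a *: f i) (g i); rewrite rnormZ.
  have := rnorm_ge0 (a *: f i + g i).
  have := sqr_ge0 (rnorm (a : R[i]^o) * rnorm (f i) - rnorm (g i)).
  by rewrite -exprMn; nra.
apply: le_trans (ler_sum _ (fun i _ => le i)) _.
rewrite -mulr_sumr ler_pM2l // big_split /= -mulr_sumr lerD //.
by rewrite ler_wpM2l // ?exprn_ge0 // rnorm_ge0.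
Qed.

HB.instance Definition _ :=
  GRing.isSubmodClosed.Build R[i] (I -> R[i]^o) l2_pred l2_submod_closed.
HB.instance Definition _ := [SubChoice_isSubLmodule of l2 by <:].

End L2.

Section L2Dot.
Context {R : realType} {I : choiceType}.
Implicit Types a b c : l2 R I.

Lemma l2P a b : (forall i, a i = b i) -> a = b.
Proof. by move=> ab; apply/val_inj/funext. Qed.

Lemma l2_bounded a : exists b : R, forall A : {fset I}, \sum_(i <- A) rnorm (a i) ^+ 2 <= b.
Proof. by case: a => a /= /set_mem. Qed.

Lemma rnorm_sqrE (z : R[i]^o) : (rnorm z ^+ 2)%:C = z * Num.conj (z : R[i]).
Proof. by rewrite rmorphXn /= rnormE normCK. Qed.

Lemma l2_sqsum a : exists2 s : R, is_hsum (fun i => a i * Num.conj (a i : R[i])) s%:C &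
  (forall A : {fset I}, \sum_(i <- A) rnorm (a i) ^+ 2 <= s) /\
  forall e : R, (forall A : {fset I}, \sum_(i <- A) rnorm (a i) ^+ 2 <= e) -> s <= e.
Proof.
have [b ab] := l2_bounded a.
have [//|s hs ss] := @is_hsum_real R I (fun i => rnorm (a i) ^+ 2) b _ ab.
  by move=> i; exact: sqr_ge0.
exists s => //; move: hs; congr (is_hsum _ _).
by apply/funext => i; rewrite rnorm_sqrE.
Qed.

Lemma polarization (z w : R[i]) : z * Num.conj w = 4%:R^-1 *
  ((z + w) * Num.conj (z + w) + (-1) * ((z - w) * Num.conj (z - w)) +
   'i%C * ((z + 'i%C * w) * Num.conj (z + 'i%C * w)) +
   - 'i%C * ((z - 'i%C * w) * Num.conj (z - 'i%C * w))).
Proof.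
rewrite !rmorphD !rmorphN !rmorphM /=.
have -> : Num.conj 'i%C = - 'i%C :> R[i] by simpc.
have i2 : 'i%C * 'i%C = -1 :> R[i] by rewrite -expr2 sqr_i.
by field: i2.
Qed.

(** Polarization reduces convergence to the four sums of squares of [a + b], [a - b], [a + i b] and
    [a - i b]. *)
Lemma l2_dot_ex a b : exists l, is_hsum (fun i => a i * Num.conj (b i : R[i])) l.
Proof.
have [s1 h1 _] := l2_sqsum (a + b); have [s2 h2 _] := l2_sqsum (a - b).
have [s3 h3 _] := l2_sqsum (a + 'i%C *: b).
have [s4 h4 _] := l2_sqsum (a - 'i%C *: b).
have h := is_hsumZ 4%:R^-1 (is_hsumD (is_hsumD (is_hsumD h1 (is_hsumZ (-1) h2))
  (is_hsumZ 'i%C h3)) (is_hsumZ (- 'i%C) h4)).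
eexists; move: h; congr (is_hsum _ _); apply/funext => i.
by rewrite [RHS]polarization.
Qed.

Definition l2_dot a b : R[i] :=
  xget 0 [set l | is_hsum (fun i => a i * Num.conj (b i : R[i])) l].

Lemma l2_dotP a b : is_hsum (fun i => a i * Num.conj (b i : R[i])) (l2_dot a b).
Proof.
by rewrite /l2_dot; have [l hl] := l2_dot_ex a b; exact: (xgetPex 0 (ex_intro _ l hl)).
Qed.

Arguments l2_dotP : clear implicits.

Lemma l2_dot_unique a b (l : R[i]) :
  is_hsum (fun i => a i * Num.conj (b i : R[i])) l -> l2_dot a b = l.
Proof. by move=> h; exact: is_hsum_unique (l2_dotP a b) h. Qed.

Lemma l2_dot_linearl b : GRing.linear_for *%R (l2_dot^~ b).
Proof.
move=> k a c; apply: l2_dot_unique.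
have := is_hsumD (is_hsumZ k (l2_dotP a b)) (l2_dotP c b).
congr (is_hsum _ _); apply/funext => i.
by rewrite -[(k *: a + c) i]/(k * (a i : R[i]) + c i) mulrDl mulrA.
Qed.

Lemma l2_dotC a b : l2_dot a b = Num.conj (l2_dot b a).
Proof.
apply: l2_dot_unique; have := is_hsum_conj (l2_dotP b a).
congr (is_hsum _ _); apply/funext => i.
by rewrite rmorphM /= conjCK mulrC.
Qed.

Lemma l2_dot_linearr a : GRing.linear_for (Num.conj \; *%R) (l2_dot a).
Proof.
move=> k b c; rewrite l2_dotC l2_dot_linearl rmorphD rmorphM /=.
by rewrite -!l2_dotC.
Qed.

HB.instance Definition _ := @bilinear_isBilinear.Build R[i] (l2 R I) (l2 R I) R[i]
  *%R (Num.conj \; *%R) l2_dot (l2_dot_linearl, l2_dot_linearr).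

Lemma l2_dot_hermitian a b : l2_dot a b = (-1) ^+ false * Num.conj (l2_dot b a).
Proof. by rewrite expr0 mul1r -l2_dotC. Qed.

HB.instance Definition _ := @isHermitianSesquilinear.Build R[i] (l2 R I) false
  Num.conj l2_dot l2_dot_hermitian.

Lemma l2_dot_gt0 a : a != 0 -> 0 < l2_dot a a.
Proof.
move=> a0; have [s hs [les _]] := l2_sqsum a.
rewrite (l2_dot_unique hs) ltcR lt_neqAle; apply/andP; split; last first.
  by have := les fset0; rewrite big_seq_fset0.
apply: contraNneq a0 => s0; apply/eqP/l2P => i.
apply: rnorm_eq0; have := les [fset i]%fset; rewrite big_seq_fset1 -s0 => h.
by apply/eqP; rewrite -sqrf_eq0 eq_le h sqr_ge0.
Qed.

HB.instance Definition _ := @isDotProduct.Build R[i] (l2 R I) l2_dot l2_dot_gt0.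

End L2Dot.

Arguments l2_dotP {R I} a b.

Section L2Norm.
Context {R : realType} {I : choiceType}.
Implicit Types a b c : l2 R I.

Let norm a : R[i] := sqrtC (l2_dot a a).

Let norm_triangle a b : norm (a + b) <= norm a + norm b.
Proof. exact: dot_triangle. Qed.

Let normZ (k : R[i]) a : norm (k *: a) = `|k| * norm a.
Proof.
rewrite /norm dnormZ sqrtCM ?nnegrE ?exprn_ge0 ?dnorm_ge0 //.
by rewrite sqrCK.
Qed.

Let norm_eq0 a : norm a = 0 -> a = 0.
Proof. by move/eqP; rewrite sqrt_dnorm_eq0 => /eqP. Qed.

HB.instance Definition _ :=
  Lmodule_isNormed.Build R[i] (l2 R I) norm_triangle normZ norm_eq0.

Lemma l2_normE a : `|a| ^+ 2 = l2_dot a a.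
Proof. exact: sqrtCK. Qed.

Lemma l2_rnormE a : (rnorm a ^+ 2)%:C = l2_dot a a.
Proof. by rewrite rmorphXn /= rnormE l2_normE. Qed.

Lemma l2_sum_le a (A : {fset I}) : \sum_(i <- A) rnorm (a i) ^+ 2 <= rnorm a ^+ 2.
Proof.
have [s hs [les _]] := l2_sqsum a; apply: le_trans (les A) _.
by rewrite -lecR l2_rnormE (l2_dot_unique hs).
Qed.

Lemma l2_norm_le a (e : R) : 0 <= e ->
  (forall A : {fset I}, \sum_(i <- A) rnorm (a i) ^+ 2 <= e ^+ 2) -> rnorm a <= e.
Proof.
move=> e0 ae; have [s hs [_ sle]] := l2_sqsum a.
rewrite -ler_sqr ?nnegrE ?rnorm_ge0 //; apply: le_trans (sle _ ae).
by rewrite -lecR l2_rnormE (l2_dot_unique hs).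
Qed.

Lemma l2_coord_le a i : rnorm (a i) <= rnorm a.
Proof.
rewrite -ler_sqr ?nnegrE ?rnorm_ge0 //.
by have := l2_sum_le a [fset i]%fset; rewrite big_seq_fset1.
Qed.

Lemma cvg_rnorm (V : normedModType R[i]) (T : Type) (F : set_system T) {FF : Filter F}
    (f : T -> V) (l : V) :
  f @ F --> l -> (rnorm (f t) : R^o) @[t --> F] --> (rnorm l : R^o).
Proof.
move=> /cvg_rnormP fl; apply/(@cvgrPdist_lt R R^o) => e e0.
apply: filterS (fl e e0) => t; apply: le_lt_trans.
rewrite ler_norml; apply/andP; split.
  rewrite lerNl opprB lerBlDr -[f t in leLHS](subrK l).
  by rewrite (le_trans (rnormD _ _)) // -rnormN opprB lerD2r.
by rewrite lerBlDr -[l in leLHS](subrK (f t)) rnormD.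
Qed.

Lemma cauchy_rnormP (V : normedModType R[i]) (F : set_system V) : ProperFilter F ->
  cauchy F <-> forall e : R, 0 < e -> exists x : V, \forall y \near F, rnorm (x - y) < e.
Proof.
move=> FF; split=> [/cauchyP Fc e e0|Fc].
  have [|x Fx] := Fc e%:C; first by rewrite ltcR.
  exists x; apply: filterS Fx => y.
  by rewrite -ball_normE /ball_ /= -rnormE ltcR.
apply/cauchyP => e /gtr0_complexP[e0 ->].
have [x Fx] := Fc _ e0; exists x; apply: filterS Fx => y.
by rewrite -ball_normE /ball_ /= -rnormE ltcR.
Qed.

Lemma complex_complete (F : set_system R[i]^o) : ProperFilter F -> cauchy F ->
  exists l : R[i]^o, F --> l.
Proof.
move=> FF /cauchy_rnormP Fc.
have cvg_part (p : R[i]^o -> R) : (forall z w, `|p z - p w| <= rnorm (z - w)) ->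
    exists l : R, forall e : R, 0 < e -> \forall z \near F, `|l - p z| < e.
  move=> pl; have : cauchy (p @ F).
    apply/cauchyP => e e0; have [z Fz] := Fc _ e0; exists (p z).
    apply: filterS Fz => w /=; apply: le_lt_trans; exact: pl.
  move/(@cauchy_cvg R) => /cvg_ex[l /= pFl]; exists l => e e0.
  exact: (@cvgrPdist_lt R R^o _ _ _ _ _).1 pFl e e0.
have [|a ha] := cvg_part (fun z => complex.Re (z : R[i])).
  by move=> z w; rewrite -[X in `|X|](raddfB (@complex.Re R : Rcomplex R -> R)) rnorm_Re.
have [|b hb] := cvg_part (fun z => complex.Im (z : R[i])).
  by move=> z w; rewrite -[X in `|X|](raddfB (@complex.Im R : Rcomplex R -> R)) rnorm_Im.
exists (a +i* b : R[i]^o); apply/(@cvg_rnormP R R[i]^o _ F _ id) => e e0.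
have e2 : 0 < e / 2 by rewrite divr_gt0.
apply: filterS2 (ha _ e2) (hb _ e2) => z az bz.
have -> : (a +i* b : R[i]^o) - z =
   (a - complex.Re (z : R[i]))%:C + 'i%C * (b - complex.Im (z : R[i]))%:C.
  by case: z {az bz} => c d; simpc.
apply: le_lt_trans (rnormD _ _) _.
by rewrite -[_ * _]/('i%C *: _) rnormZ !rnormC rnorm_i mul1r; lra.
Qed.

(** The limit [c] is taken coordinatewise. Bounds on [b - c] are proved for finite partial sums,
    which pass to the limit, and then carried to the norm, a supremum of such sums. *)
Lemma l2_complete (F : set_system (l2 R I)) : ProperFilter F -> cauchy F -> cvg F.
Proof.
move=> FF /cauchy_rnormP Fc.
have coordB a b i : (a - b) i = a i - b i by [].
have /choice[c hc] i : exists l : R[i]^o, (fun a : l2 R I => a i) @ F --> l.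
  apply: complex_complete; apply/cauchy_rnormP => e e0.
  have [a Fa] := Fc e e0; exists (a i); apply: filterS Fa => b /=.
  by apply: le_lt_trans; rewrite -coordB l2_coord_le.
have c_le b (e : R) : 0 < e -> (\forall a \near F, rnorm (b - a) < e) ->
    forall A : {fset I}, \sum_(i <- A) rnorm (b i - c i) ^+ 2 <= e ^+ 2.
  move=> e0 Fb A.
  have h (s : seq I) :
      (fun a : l2 R I => \sum_(i <- s) rnorm (b i - a i) ^+ 2 : R^o) @ F -->
      (\sum_(i <- s) rnorm (b i - c i) ^+ 2 : R^o).
    elim: s => [|i s IHs].
      by rewrite big_nil; under eq_cvg do rewrite big_nil; exact: cvg_cst.
    rewrite big_cons; under eq_cvg do rewrite big_cons.
    apply: (@cvgD R R^o) IHs; rewrite expr2; under eq_cvg do rewrite expr2.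
    have ci : (fun a : l2 R I => rnorm (b i - a i) : R^o) @ F --> (rnorm (b i - c i) : R^o).
      apply: cvg_rnorm; apply: (@cvgB R[i] R[i]^o) (hc i); exact: cvg_cst.
    exact: (@cvgM R).
  apply: (cvgr_to_le (h A)); apply: filterS Fb => a ba.
  apply: le_trans (l2_sum_le (b - a) A) _.
  by rewrite ler_sqr ?nnegrE ?rnorm_ge0 // ltW.
have [b0 Fb0] := Fc 1 ltr01.
(* What is known to be square-summable is [b0 - c], so [c] enters l2 as [b0] minus this element. *)
have dP : (fun i => b0 i - c i : R[i]^o) \in @l2_pred R I.
  by apply/mem_set; exists (1 ^+ 2) => A; exact: c_le.
pose l : l2 R I := b0 - L2 dP.
have lE i : l i = c i by rewrite /l coordB /= opprB addrC subrK.
apply/cvg_ex; exists l; apply/(@cvg_rnormP R (l2 R I) _ F _ id) => e e0.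
have e2 : 0 < e / 2 by rewrite divr_gt0.
have [b Fb] := Fc _ e2; apply: filterS (Fb) => a ba.
have bl : rnorm (b - l) <= e / 2.
  apply: l2_norm_le => [|A]; first exact: ltW.
  have -> : \sum_(i <- A) rnorm ((b - l) i) ^+ 2 = \sum_(i <- A) rnorm (b i - c i) ^+ 2.
    by apply: eq_bigr => i _; rewrite coordB lE.
  exact: c_le.
have -> : l - a = (l - b) + (b - a) by rewrite addrA subrK.
apply: le_lt_trans (rnormD _ _) _; rewrite -rnormN opprB (splitr e).
exact: ler_ltD.
Qed.

HB.instance Definition _ := Uniform_isComplete.Build (l2 R I) l2_complete.

Definition l2_hilbert : hilbertType R := @Hilbert R (l2 R I) l2_dot l2_normE.

End L2Norm.

Arguments l2_hilbert : clear implicits.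

(** * Operators and representations *)

Section Hilbert.
Context {R : realType} {H : hilbertType R}.
Implicit Types (x y z v w : H) (S T : B(H)).

Lemma innerDl x y z : '<x + y, z> = '<x, z> + '<y, z>.
Proof. exact: linearDl. Qed.

Lemma innerDr x y z : '<x, y + z> = '<x, y> + '<x, z>.
Proof. exact: linearDr. Qed.

Lemma innerNl x y : '<- x, y> = - '<x, y>.
Proof. exact: linearNl. Qed.

Lemma innerNr x y : '<x, - y> = - '<x, y>.
Proof. exact: linearNr. Qed.

Lemma innerZl (a : R[i]) x y : '<a *: x, y> = a * '<x, y>.
Proof. exact: linearZl_LR. Qed.

Lemma innerZr (a : R[i]) x y : '<x, a *: y> = Num.conj a * '<x, y>.
Proof. exact: linearZr_LR. Qed.

Lemma inner0l x : '<0, x> = 0.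
Proof. exact: linear0l. Qed.

Lemma inner0r x : '<x, 0> = 0.
Proof. exact: linear0r. Qed.

Lemma innerC x y : '<x, y> = Num.conj '<y, x>.
Proof. by have := @hermitian_subproof _ _ _ _ (inner H) x y; rewrite expr0 mul1r. Qed.

Lemma inner_ge0 x : 0 <= '<x, x>.
Proof. by rewrite -inner_norm exprn_ge0. Qed.

Lemma inner_rnorm x : '<x, x> = (rnorm x ^+ 2)%:C.
Proof. by rewrite rmorphXn /= rnormE inner_norm. Qed.

Lemma inner_eq0 x : '<x, x> = 0 -> x = 0.
Proof. by rewrite -inner_norm => /eqP; rewrite sqrf_eq0 normr_eq0 => /eqP. Qed.

Lemma inner_ext x y : (forall z, '<x, z> = '<y, z>) -> x = y.
Proof.
move=> h; apply/eqP; rewrite -subr_eq0; apply/eqP/inner_eq0.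
by rewrite innerDl innerNl h subrr.
Qed.

Lemma rnorm_inner_le x y : rnorm ('<x, y> : R[i]^o) <= rnorm x * rnorm y.
Proof.
rewrite -ler_sqr ?nnegrE ?mulr_ge0 ?rnorm_ge0 // exprMn.
have := dot_Cauchy_Schwarz (inner H) x y.
by rewrite !inner_rnorm -(@rnormE R R[i]^o) -rmorphXn -rmorphM lecR.
Qed.

Lemma bopD T x y : T (x + y) = T x + T y.
Proof. by have := bop_linear T 1 x y; rewrite !scale1r. Qed.

Lemma bop0 T : T 0 = 0.
Proof. by apply: (addrI (T 0)); rewrite -bopD !addr0. Qed.

Lemma bopZ T (a : R[i]) x : T (a *: x) = a *: T x.
Proof. by have := bop_linear T a x 0; rewrite bop0 !addr0. Qed.

Lemma bopN T x : T (- x) = - T x.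
Proof. by rewrite -scaleN1r bopZ scaleN1r. Qed.

Lemma bopB T x y : T (x - y) = T x - T y.
Proof. by rewrite bopD bopN. Qed.

Lemma bop_addE S T x : (S + T) x = S x + T x. Proof. by []. Qed.
Lemma bop_oppE T x : (- T) x = - T x. Proof. by []. Qed.
Lemma bop_scaleE (a : R[i]) T x : (a *: T) x = a *: T x. Proof. by []. Qed.
Lemma bop_mulE S T x : (S * T) x = S (T x). Proof. by []. Qed.
Lemma bop_oneE x : (1 : B(H)) x = x. Proof. by []. Qed.
Lemma bop_zeroE x : (0 : B(H)) x = 0. Proof. by []. Qed.
Definition bopE := (bop_addE, bop_oppE, bop_scaleE, bop_mulE, bop_oneE, bop_zeroE).

(** [adj T] is a chosen adjoint; uniqueness of adjoints identifies it with [S]. *)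
Lemma adj_eq S T : (forall x y, '<T x, y> = '<x, S y>) -> adj T = S.
Proof.
move=> TS; rewrite /adj; case: xgetP => [S' _ TS'|/(_ S)//].
apply/bopP => y; apply: inner_ext => z.
by rewrite innerC [RHS]innerC -TS -TS'.
Qed.

Lemma bounded_bop (T : H -> H) (b : R) : linear T ->
  (forall x, rnorm (T x) <= b * rnorm x) -> T \in @blin R H.
Proof.
move=> lT bT; apply/mem_set; split=> // x; apply/cvg_rnormP => e e0.
have b1 : 0 < `|b| + 1 by rewrite ltr_wpDl.
have e1 : 0 < e / (`|b| + 1) by rewrite divr_gt0.
apply: filterS (near_rnorm x e1) => y.
rewrite ltr_pdivlMr // => h; apply: le_lt_trans h.
have -> : T x - T y = T (x - y).
  by have := lT (-1) y x; rewrite !scaleN1r => h; rewrite addrC -h addrC.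
apply: le_trans (bT _) _; rewrite mulrC ler_wpM2l ?rnorm_ge0 //.
by apply: le_trans (ler_norm _) _; rewrite lerDl.
Qed.

(** Evaluating at [x + y] and at [x + i y] gives two linear equations in [D x y] and [D y x], which
    force both to vanish. *)
Lemma sesqui_diag0 (D : H -> H -> R[i]) :
  (forall x y z, D (x + y) z = D x z + D y z) ->
  (forall x y z, D x (y + z) = D x y + D x z) ->
  (forall x y, D ('i%C *: x) y = 'i%C * D x y) ->
  (forall x y, D x ('i%C *: y) = - 'i%C * D x y) ->
  (forall x, D x x = 0) -> forall x y, D x y = 0.
Proof.
move=> Dl Dr Zl Zr D0 x y.
have h1 : D x y + D y x = 0.
  by have := D0 (x + y); rewrite Dl !Dr !D0 add0r addr0.
have h2 : - 'i%C * D x y + 'i%C * D y x = 0.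
  by have := D0 (x + 'i%C *: y); rewrite Dl !Dr !D0 Zl Zr add0r addr0.
have i2 : 'i%C * 'i%C = -1 :> R[i] by rewrite -expr2 sqr_i.
have : 2%:R * D x y = 0.
  have -> : 2%:R * D x y = (D x y + D y x) + 'i%C * (- 'i%C * D x y + 'i%C * D y x).
    by ring: i2.
  by rewrite h1 h2 mulr0 addr0.
by move/eqP; rewrite mulf_eq0 pnatr_eq0 /= => /eqP.
Qed.

Lemma bop_diag_ext S T : (forall v, '<S v, v> = '<T v, v>) -> S = T.
Proof.
move=> ST; apply/bopP => x; apply: inner_ext => y; apply/eqP; rewrite -subr_eq0.
apply/eqP; move: x y; apply: (@sesqui_diag0 (fun x y => '<S x, y> - '<T x, y>)).
- by move=> x y z; rewrite !bopD !innerDl; ring.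
- by move=> x y z; rewrite !innerDr; ring.
- by move=> x y; rewrite !bopZ !innerZl; ring.
- move=> x y; rewrite !innerZr /=.
  have -> : Num.conj 'i%C = - 'i%C :> R[i] by simpc.
  by ring.
- by move=> x; rewrite ST subrr.
Qed.

End Hilbert.

(** * Reflections *)

Section Reflection.
Context {R : realType} {H : hilbertType R} (w : H).
Hypothesis w2 : '<w, w> = 2%:R.

(** With [w] of squared norm 2 this is the reflection in the hyperplane orthogonal to [w]. For
    [w = e - e'] with [e], [e'] orthonormal it exchanges [e] and [e']. *)
Let refl_fun (x : H) : H := x - '<x, w> *: w.

Let refl_linear : linear refl_fun.
Proof.
move=> a x y; rewrite /refl_fun innerDl innerZl scalerDl scalerBr scalerA opprD.
by rewrite addrACA.
Qed.

Let refl_blin : refl_fun \in @blin R H.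
Proof.
apply: (@bounded_bop _ _ _ (1 + rnorm w * rnorm w)) => // x.
apply: le_trans (rnormD _ _) _; rewrite rnormN rnormZ mulrDl mul1r lerD2l.
have -> : rnorm w * rnorm w * rnorm x = rnorm x * rnorm w * rnorm w by ring.
by rewrite ler_wpM2r ?rnorm_ge0 ?rnorm_inner_le.
Qed.

Definition reflection : B(H) := Bop refl_blin.

Lemma reflectionE x : reflection x = x - '<x, w> *: w.
Proof. by []. Qed.

Lemma reflection_inner x y : '<reflection x, y> = '<x, reflection y>.
Proof.
rewrite !reflectionE innerDl innerDr innerNl innerNr innerZl innerZr.
by rewrite mulrC (innerC w y).
Qed.

Lemma adj_reflection : adj reflection = reflection.
Proof. exact/adj_eq/reflection_inner. Qed.

Lemma reflectionK x : reflection (reflection x) = x.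
Proof.
rewrite !reflectionE innerDl innerNl innerZl w2.
have -> : '<x, w> + - ('<x, w> * 2%:R) = - '<x, w> by ring.
by rewrite scaleNr opprK subrK.
Qed.

Lemma unitary_reflection : unitary reflection.
Proof. by rewrite /unitary adj_reflection; split; apply/bopP; exact: reflectionK. Qed.

End Reflection.

(** * Positive functions *)

Section Positivity.
Context {R : realType} {X : topologicalType} (X_compact : compact [set: X]).
Implicit Types f g : C(X; R).

Definition cpos f : Prop := forall x, 0 <= (f x : R[i]).

Lemma cpos_fre f x : cpos f -> 0 <= fre f x.
Proof. by move=> /(_ x); rewrite lecE => /andP[]. Qed.

Lemma mxpos_const f : cpos f -> mxpos_CX (const_mx f : 'M_1).
Proof.
move=> f0 x u; rewrite !big_ord1 mxE -mulrA mulr_ge0 //.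
by rewrite -normCK exprn_ge0.
Qed.

Lemma cpos_modsq f : cpos (cconj f * f).
Proof. by move=> x; rewrite !cfunE mulrC -normCK exprn_ge0. Qed.

Lemma cpos_sqrt f : cpos f -> exists2 s, cconj s = s & s * s = f.
Proof.
move=> f0; have cs : continuous (fun x => Num.sqrt (fre f x)).
  move=> x; apply: continuous_comp; first exact: continuous_fre.
  exact: sqrt_continuous.
exists (rfun cs); apply: cfunP => x; rewrite !cfunE !rfunE; first exact: conjc_real.
have := f0 x; move: (ger0_complexE (f0 x)) => -> ; rewrite ler0c => fx.
by rewrite -rmorphM -expr2 sqr_sqrtr.
Qed.

Lemma cconjK f : cconj (cconj f) = f.
Proof. by apply: cfunP => x; rewrite !cfunE conjCK. Qed.

Lemma cconj_rfun (h : X -> R) (hc : continuous h) : cconj (rfun hc) = rfun hc.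
Proof. by apply: cfunP => x; rewrite !cfunE !rfunE; exact: conjc_real. Qed.

Lemma cconj_i : Num.conj 'i%C = - 'i%C :> R[i].
Proof. by simpc. Qed.

Lemma cconj_re_im f : cconj f =
  rfun (@continuous_fre _ _ f) - 'i%C *: rfun (@continuous_fim _ _ f).
Proof.
by rewrite {1}(cfun_re_im f); apply: cfunP => x; rewrite !cfunE !rfunE; simpc.
Qed.

Lemma cfun_real f x : cconj f = f -> (f x : R[i]) = (fre f x)%:C.
Proof.
move=> fr; have := congr1 (fun g : C(X; R) => (g x : R[i])) fr; rewrite cfunE /fre.
by case: (f x : R[i]) => a b /= [] bb; simpc; congr (_ +i* _); lra.
Qed.

Lemma cpos_supnormB f : cconj f = f -> cpos ((supnorm f)%:C *: (1 : C(X; R)) - f).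
Proof.
move=> fr x; rewrite !cfunE mulr1 subr_ge0.
by rewrite cfun_real // lecR; apply: le_trans (ler_norm _) (ler_fre_supnorm X_compact f x).
Qed.

Lemma cpos_supnorm_modsq f :
  cpos ((supnorm f ^+ 2)%:C *: (1 : C(X; R)) - cconj f * f).
Proof.
move=> x; rewrite !cfunE mulr1 subr_ge0 mulrC -normCK -(@rnormE R R[i]^o) -rmorphXn lecR.
by rewrite ler_sqr ?nnegrE ?rnorm_ge0 ?supnorm_ge0 ?le_supnorm.
Qed.

End Positivity.

(** * Representations of C(X) *)

Section StarRep.
Context {R : realType} {X : topologicalType} (X_compact : compact [set: X]).
Context {H : hilbertType R}.
Implicit Types (f g : C(X; R)) (x y v : H).

(** If [T] had no adjoint, [adj T] would be the default value 0; then [T = 0] and the identity is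
    trivial. *)
Lemma adj_selfadj (T : B(H)) : T = adj T -> forall x y, '<T x, y> = '<x, T y>.
Proof.
move=> TT x y; have : adj T = T by [].
rewrite /adj; case: xgetP => [S _ TS ST|_ T0]; first by rewrite -[in RHS]ST; exact: TS.
by rewrite -T0 !bopE inner0l inner0r.
Qed.

Context (pi : C(X; R) -> B(H)) (pi_rep : star_rep pi).

Lemma star_repD f g : pi (f + g) = pi f + pi g.
Proof. by have [h _ _ _] := pi_rep; have := h 1 f g; rewrite !scale1r. Qed.

Lemma star_rep0 : pi 0 = 0.
Proof. by apply: (addrI (pi 0)); rewrite -star_repD !addr0. Qed.

Lemma star_repZ (a : R[i]) f : pi (a *: f) = a *: pi f.
Proof. by have [h _ _ _] := pi_rep; have := h a f 0; rewrite star_rep0 !addr0. Qed.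

Lemma star_repN f : pi (- f) = - pi f.
Proof. by rewrite -scaleN1r star_repZ scaleN1r. Qed.

Lemma star_repB f g : pi (f - g) = pi f - pi g.
Proof. by rewrite star_repD star_repN. Qed.

Lemma star_repM f g : pi (f * g) = pi f * pi g.
Proof. by have [_ _ h _] := pi_rep. Qed.

Lemma star_rep1 : pi 1 = 1.
Proof. by have [_ h _ _] := pi_rep. Qed.

(* [adj T] is junk when T has no adjoint, so this is not immediate. *)
Lemma star_rep_inner f x y : '<pi f x, y> = '<x, pi (cconj f) y>.
Proof.
have [_ _ _ piC] := pi_rep.
have sa (h : X -> R) (hc : continuous h) u v :
    '<pi (rfun hc) u, v> = '<u, pi (rfun hc) v>.
  by apply: adj_selfadj; rewrite -piC cconj_rfun.
rewrite cconj_re_im {1}(cfun_re_im f) star_repD star_repB !star_repZ !bopE.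
by rewrite innerDl innerDr innerNr innerZl innerZr !sa cconj_i mulNr opprK.
Qed.

Lemma star_rep_ge0 f v : cpos f -> 0 <= '<pi f v, v>.
Proof.
move=> /cpos_sqrt[s sr <-]; rewrite star_repM bopE star_rep_inner sr.
exact: inner_ge0.
Qed.

Lemma star_rep_modsq f v : '<pi f v, pi f v> = '<pi (cconj f * f) v, v>.
Proof. by rewrite star_repM bopE [RHS]star_rep_inner cconjK. Qed.

(** The function [supnorm f ^+ 2 - |f|^2] is nonnegative, and [pi] is positive. *)
Lemma star_rep_contractive f v : rnorm (pi f v) <= supnorm f * rnorm v.
Proof.
rewrite -ler_sqr ?nnegrE ?mulr_ge0 ?rnorm_ge0 ?supnorm_ge0 // exprMn.
suff : (rnorm (pi f v) ^+ 2)%:C <= (supnorm f ^+ 2)%:C * (rnorm v ^+ 2)%:C.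
  by rewrite -rmorphM lecR.
rewrite -!inner_rnorm star_rep_modsq -subr_ge0.
have := star_rep_ge0 v (cpos_supnorm_modsq X_compact f).
rewrite star_repB star_repZ star_rep1 !bopE innerDl innerNl innerZl; exact.
Qed.

Lemma opnorm_le (T : B(H)) (b : R) : 0 <= b ->
  (forall x, rnorm (T x) <= b * rnorm x) -> opnorm T <= b.
Proof.
move=> b0 Tb; apply: ge_sup.
  by exists (rnorm (T 0)); exists 0 => //=; rewrite rnorm0.
move=> _ [x /= x1 <-]; apply: le_trans (Tb x) _.
by rewrite ler_piMr.
Qed.

Lemma opnorm_star_rep f : opnorm (pi f) <= supnorm f.
Proof. by apply: opnorm_le; [exact: supnorm_ge0 | exact: star_rep_contractive]. Qed.

End StarRep.

(** * Unital completely positive maps *)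

Section Ucp.
Context {R : realType} {X : topologicalType} (X_compact : compact [set: X]).
Context {H : hilbertType R}.
Context (psi : C(X; R) -> B(H)) (psi_ucp : ucp psi).
Implicit Types (f g : C(X; R)) (x y v : H).

Lemma ucpD f g : psi (f + g) = psi f + psi g.
Proof. by have [h _ _] := psi_ucp; have := h 1 f g; rewrite !scale1r. Qed.

Lemma ucp0 : psi 0 = 0.
Proof. by apply: (addrI (psi 0)); rewrite -ucpD !addr0. Qed.

Lemma ucpZ (a : R[i]) f : psi (a *: f) = a *: psi f.
Proof. by have [h _ _] := psi_ucp; have := h a f 0; rewrite ucp0 !addr0. Qed.

Lemma ucpN f : psi (- f) = - psi f.
Proof. by rewrite -scaleN1r ucpZ scaleN1r. Qed.

Lemma ucpB f g : psi (f - g) = psi f - psi g.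
Proof. by rewrite ucpD ucpN. Qed.

Lemma ucp1 : psi 1 = 1.
Proof. by have [_ h _] := psi_ucp. Qed.

Lemma ucp_ge0 f v : cpos f -> 0 <= '<psi f v, v>.
Proof.
move=> f0; have [_ _ pos] := psi_ucp.
by have := pos _ _ (mxpos_const f0) (fun=> v); rewrite !big_ord1 !mxE.
Qed.

Lemma ucp_state v : '<v, v> = 1 -> state (fun f => '<psi f v, v>).
Proof.
move=> v1; split=> [a f g||f f0]; last exact: ucp_ge0.
  by rewrite ucpD ucpZ !bopE innerDl innerZl.
by rewrite ucp1 bopE.
Qed.

(** For real [h] the function [supnorm h - h] is nonnegative, so the quadratic form of [psi h] is
    real; polarization makes [psi h] symmetric. The general case splits [f] into real and imaginary
    parts. *)
Lemma ucp_inner f x y : '<psi f x, y> = '<x, psi (cconj f) y>.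
Proof.
have sa (h : X -> R) (hc : continuous h) u v :
    '<psi (rfun hc) u, v> = '<u, psi (rfun hc) v>.
  apply/eqP; rewrite -subr_eq0; apply/eqP; move: u v.
  apply: (@sesqui_diag0 _ _ (fun u v => '<psi (rfun hc) u, v> - '<u, psi (rfun hc) v>)).
  - by move=> u v w; rewrite bopD !innerDl; ring.
  - by move=> u v w; rewrite bopD !innerDr; ring.
  - by move=> u v; rewrite !bopZ !innerZl; ring.
  - by move=> u v; rewrite !bopZ !innerZr /= cconj_i; ring.
  move=> v; set B := supnorm (rfun hc).
  have : 0 <= '<psi (B%:C *: (1 : C(X; R)) - rfun hc) v, v>.
    by apply: ucp_ge0; apply: cpos_supnormB => //; exact: cconj_rfun.
  rewrite ucpB ucpZ ucp1 !bopE innerDl innerNl innerZl => /ger0_real h1.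
  have h2 : B%:C * '<v, v> \is Num.real.
    by rewrite realM ?ger0_real ?inner_ge0 // ler0c supnorm_ge0.
  have vr : '<psi (rfun hc) v, v> \is Num.real.
    by rewrite -[X in X \is _](subKr (B%:C * '<v, v>)) rpredB.
  by rewrite [X in _ - X]innerC (CrealP vr) subrr.
rewrite cconj_re_im {1}(cfun_re_im f) ucpD ucpB !ucpZ !bopE.
by rewrite innerDl innerDr innerNr innerZl innerZr !sa cconj_i mulNr opprK.
Qed.

Lemma mxpos_gram n (a : 'I_n -> C(X; R)) :
  mxpos_CX (\matrix_(i, j) (cconj (a i) * a j)).
Proof.
move=> x v; have -> : \sum_i \sum_j ((\matrix_(i, j) (cconj (a i) * a j)) i j x : R[i]) *
   v j * Num.conj (v i) =
   (\sum_j (a j x : R[i]) * v j) * Num.conj (\sum_i (a i x : R[i]) * v i).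
  rewrite rmorph_sum mulr_sumr; apply: eq_bigr => i _.
  rewrite mulr_suml; apply: eq_bigr => j _.
  by rewrite mxE !cfunE rmorphM; ring.
by rewrite -normCK exprn_ge0.
Qed.

(* Kadison-Schwarz: test the positivity of psi on [[1, f], [f^*, f^* f]] at the
   vector (- psi f v, v). *)
Lemma ucp_schwarz f v : '<psi f v, psi f v> <= '<psi (cconj f * f) v, v>.
Proof.
have [_ _ pos] := psi_ucp.
pose a (i : 'I_2) := if i == 0 then 1 else f.
pose u (i : 'I_2) := if i == 0 then - psi f v else v.
have := pos _ _ (mxpos_gram a) u.
rewrite !big_ord_recl !big_ord0 !mxE /a /u /= !addr0.
have c1 : cconj (1 : C(X; R)) = 1 by apply: cfunP => x; rewrite !cfunE rmorph1.
rewrite c1 !mul1r !mulr1 ucp1 bopE addNr inner0l add0r.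
rewrite bopN innerDl innerNl [X in - X]ucp_inner cconjK -subr_ge0.
by rewrite addrC.
Qed.

(** Apply Kadison-Schwarz to [g = f - f(x)]: the right-hand side is [|g(x)|^2 '<v, v>], which is
    0. *)
Lemma ucp_eigenvector f v (x : X) :
  (forall g, '<psi g v, v> = (g x : R[i]) * '<v, v>) -> psi f v = (f x : R[i]) *: v.
Proof.
move=> vx; apply/eqP; rewrite -subr_eq0; apply/eqP/inner_eq0.
pose g := f - (f x : R[i]) *: (1 : C(X; R)).
have -> : psi f v - (f x : R[i]) *: v = psi g v.
  by rewrite /g ucpB ucpZ ucp1 !bopE.
apply/eqP; rewrite eq_le inner_ge0 andbT.
apply: le_trans (ucp_schwarz g v) _; rewrite vx.
by rewrite !cfunE mulr1 subrr mulr0 mul0r.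
Qed.

End Ucp.

Section HsumExtra.
Context {R : realType} {I : choiceType}.

Lemma is_hsum0 : is_hsum (fun _ : I => 0 : R[i]) 0.
Proof.
apply/cvg_rnormP => e e0; apply: nearW => A.
by rewrite big1 // subrr rnorm0.
Qed.

Lemma is_hsum_sum n (u : 'I_n -> I -> R[i]) (l : 'I_n -> R[i]) :
  (forall j, is_hsum (u j) (l j)) -> is_hsum (fun i => \sum_j u j i) (\sum_j l j).
Proof.
move=> ul; elim: (index_enum _) => [|j s IHs].
  rewrite big_nil (_ : (fun i => _) = fun=> 0); first exact: is_hsum0.
  by apply/funext => i; rewrite big_nil.
rewrite big_cons (_ : (fun i => _) = fun i => u j i + \sum_(j <- s) u j i).
  exact: is_hsumD.
by apply/funext => i; rewrite big_cons.
Qed.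

Lemma is_hsum_single (u : I -> R[i]) k : (forall i, i != k -> u i = 0) ->
  is_hsum u (u k).
Proof.
move=> uk; apply/cvg_rnormP => e e0; exists [fset k]%fset => // A /= kA.
rewrite (big_fsetD1 k) /=; last by rewrite -fsub1set.
rewrite big_seq big1 ?addr0 ?subrr ?rnorm0 // => i.
by rewrite !inE => /andP[/uk].
Qed.

End HsumExtra.

(** * The standard basis and diagonal operators *)

Section L2Basis.
Context {R : realType} {I : choiceType}.
Implicit Types (x y : l2_hilbert R I).

Lemma l2_basis_subproof (k : I) :
  (fun i => (i == k)%:R : R[i]^o) \in @l2_pred R I.
Proof.
apply/mem_set; exists 1 => A.
have z i : i != k -> rnorm ((i == k)%:R : R[i]^o) ^+ 2 = 0.
  by move=> /negPf ->; rewrite rnorm0 expr0n.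
have [kA|kA] := boolP (k \in A).
  rewrite (big_fsetD1 k) //= big_seq big1 ?addr0.
    by rewrite eqxx /rnorm normr1 expr1n.
  by move=> i; rewrite !inE => /andP[/z].
rewrite big_seq big1 // => i iA; apply: z.
by apply: contraNneq kA => <-.
Qed.

Lemma l2_addE x y i : (x + y : l2 R I) i = (x : l2 R I) i + (y : l2 R I) i.
Proof. by []. Qed.

Lemma l2_oppE x i : (- x : l2 R I) i = - (x : l2 R I) i.
Proof. by []. Qed.

Lemma l2_scaleE (a : R[i]) x i : (a *: x : l2 R I) i = a * ((x : l2 R I) i : R[i]).
Proof. by []. Qed.

Definition l2_basis k : l2_hilbert R I := L2 (l2_basis_subproof k).

Lemma inner_l2_basis x k : '<x, l2_basis k> = (x : l2 R I) k.
Proof.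
apply: l2_dot_unique.
have := @is_hsum_single R I (fun i => (x : l2 R I) i * Num.conj (l2_basis k i : R[i])) k.
rewrite /= eqxx rmorph1 mulr1; apply => i /negPf /= ->.
by rewrite rmorph0 mulr0.
Qed.

Lemma l2_basisE k i : (l2_basis k : l2 R I) i = (i == k)%:R.
Proof. by []. Qed.

Lemma rnorm_l2_basis k : rnorm (l2_basis k) = 1.
Proof.
apply/eqP; rewrite -(@eqrXn2 _ 2) ?rnorm_ge0 // expr1n; apply/eqP.
apply: (@complexI R); rewrite -inner_rnorm inner_l2_basis /=.
by rewrite eqxx.
Qed.

End L2Basis.

Section Diagonal.
Context {R : realType} {I : choiceType} (d : I -> R[i]).
Hypothesis d_bounded : exists b : R, forall i, rnorm (d i : R[i]^o) <= b.

Lemma diag_le (x : l2 R I) (b : R) : (forall i, rnorm (d i : R[i]^o) <= b) ->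
  forall A : {fset I}, \sum_(i <- A) rnorm (d i * (x i : R[i]) : R[i]^o) ^+ 2
     <= (`|b| * rnorm x) ^+ 2.
Proof.
move=> db A; have db' i : rnorm (d i : R[i]^o) <= `|b|.
  exact: le_trans (db i) (ler_norm _).
apply: le_trans (_ : \sum_(i <- A) `|b| ^+ 2 * rnorm (x i) ^+ 2 <= _).
  apply: ler_sum => i _; rewrite -[d i * _]/(d i *: x i) rnormZ -exprMn.
  by rewrite ler_sqr ?nnegrE ?mulr_ge0 ?rnorm_ge0 // ler_wpM2r ?rnorm_ge0.
by rewrite -mulr_sumr exprMn ler_wpM2l ?exprn_ge0 // l2_sum_le.
Qed.

Lemma diag_subproof (x : l2 R I) : (fun i => d i * (x i : R[i]) : R[i]^o) \in @l2_pred R I.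
Proof.
have [b db] := d_bounded; apply/mem_set.
by exists ((`|b| * rnorm x) ^+ 2) => A; exact: diag_le.
Qed.

Let diag_fun (x : l2_hilbert R I) : l2_hilbert R I := L2 (diag_subproof x).

Let diag_blin : diag_fun \in @blin R (l2_hilbert R I).
Proof.
have [b db] := d_bounded; apply: (@bounded_bop _ _ _ `|b|).
  move=> k x y; apply: l2P => i.
  rewrite -[RHS]/(k * (d i * (x : l2 R I) i) + d i * (y : l2 R I) i).
  rewrite -[LHS]/(d i * (k * (x : l2 R I) i + (y : l2 R I) i)).
  by rewrite mulrDr mulrCA.
move=> x; apply: (@l2_norm_le R I) => [|A]; last exact: diag_le.
by rewrite mulr_ge0 ?rnorm_ge0.
Qed.

Definition diag_op : B(l2_hilbert R I) := Bop diag_blin.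

End Diagonal.

Section StateMatrix.
Context {R : realType} {X : topologicalType}.

Lemma cfun_sumE m (u : 'I_m -> C(X; R)) x : (\sum_j u j) x = \sum_j (u j x : R[i]).
Proof. exact: (big_morph (fun f : C(X; R) => (f x : R[i])) (fun _ _ => erefl) erefl). Qed.

(** The sum is [phi] of the single function [G], which is nonnegative by positivity of [F] at each
    point: states are automatically completely positive. *)
Lemma state_mxpos (phi : C(X; R) -> R[i]) n (F : 'M[C(X; R)]_n) (v : 'I_n -> R[i]) :
  state phi -> mxpos_CX F -> 0 <= \sum_i \sum_j phi (F i j) * v j * Num.conj (v i).
Proof.
move=> sphi Fpos; have [_ _ pos] := sphi.
pose G := \sum_i \sum_j (v j * Num.conj (v i)) *: F i j.
have phi_sum m (u : 'I_m -> C(X; R)) : phi (\sum_j u j) = \sum_j phi (u j).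
  by apply: big_morph; [exact: stateD | exact: state0].
rewrite (_ : \sum_i _ = phi G).
  apply: pos => x; rewrite (_ : (G x : R[i]) =
    \sum_i \sum_j (F i j x : R[i]) * v j * Num.conj (v i)); first exact: Fpos.
  rewrite cfun_sumE; apply: eq_bigr => i _; rewrite cfun_sumE.
  by apply: eq_bigr => j _; rewrite cfunZE; ring.
rewrite phi_sum; apply: eq_bigr => i _; rewrite phi_sum.
by apply: eq_bigr => j _; rewrite stateZ //; ring.
Qed.

End StateMatrix.

(** * Diagonal maps built from families of states *)

Section DiagonalMap.
Context {R : realType} {X : topologicalType} (X_compact : compact [set: X]).
Context {I : choiceType}.
Implicit Types f g : C(X; R).

(** Real and imaginary parts are estimated separately, whence two summands. The point is a bound
    uniform over all states. *)
Lemma state_bounded (phi : C(X; R) -> R[i]) f : state phi ->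
  rnorm (phi f : R[i]^o) <= supnorm f + supnorm f.
Proof.
move=> sphi.
have re_le g : complex.Re (phi g) <= supnorm g.
  have -> : supnorm g = complex.Re (phi ((supnorm g)%:C *: (1 : C(X; R)))).
    by rewrite state_const.
  apply: (state_le sphi X_compact) => x; rewrite freZ mulr1.
  exact: le_trans (ler_norm _) (ler_fre_supnorm X_compact g x).
have re_abs g : `|complex.Re (phi g)| <= supnorm g.
  rewrite ler_norml re_le andbT lerNl.
  have := re_le (- g); rewrite stateN //.
  rewrite (_ : supnorm (- g) = supnorm g); first by case: (phi g).
  by rewrite /supnorm; congr sup; apply: eq_imagel => x _; rewrite cfunE rnormN.
apply: le_trans (rnorm_le_Re_Im _) _; rewrite lerD //.
have := re_abs ('i%C *: f); rewrite stateZ //.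
rewrite (_ : supnorm ('i%C *: f) = supnorm f).
  by case: (phi f) => a b /=; rewrite mul0r mul1r sub0r normrN.
rewrite /supnorm; congr sup; apply: eq_imagel => x _.
by rewrite -[('i%C *: f) x]/('i%C *: f x) rnormZ rnorm_i mul1r.
Qed.

Context (phi : I -> C(X; R) -> R[i]) (phi_state : forall i, state (phi i)).

Lemma diag_map_subproof f : exists b : R, forall i, rnorm (phi i f : R[i]^o) <= b.
Proof. by exists (supnorm f + supnorm f) => i; exact: state_bounded. Qed.

Definition diag_map f : B(l2_hilbert R I) := diag_op (diag_map_subproof f).

Lemma diag_mapE f (x : l2_hilbert R I) i :
  (diag_map f x : l2 R I) i = phi i f * ((x : l2 R I) i : R[i]).
Proof. by []. Qed.

Lemma diag_map_linear : linear diag_map.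
Proof.
move=> a f g; apply/bopP => x; apply: l2P => i.
rewrite -[RHS]/(a * (phi i f * (x : l2 R I) i) + phi i g * (x : l2 R I) i).
by rewrite diag_mapE stateD // stateZ // mulrDl mulrA.
Qed.

Lemma diag_map1 : diag_map 1 = 1.
Proof.
apply/bopP => x; apply: l2P => i; rewrite diag_mapE bop_oneE.
by have [_ -> _] := phi_state i; rewrite mul1r.
Qed.

Lemma l2_sumE n (x : 'I_n -> l2_hilbert R I) k :
  ((\sum_j x j : l2_hilbert R I) : l2 R I) k = \sum_j ((x j : l2 R I) k : R[i]).
Proof. exact: (big_morph (fun y : l2 R I => (y k : R[i])) (fun _ _ => erefl) erefl). Qed.

(** The quadratic form is a sum over coordinates [k], whose terms are nonnegative by [state_mxpos]
    for [phi k]. *)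
Lemma diag_map_ucp : ucp diag_map.
Proof.
split; [exact: diag_map_linear | exact: diag_map1 | move=> n F Fpos v].
have h i : is_hsum (fun k => (\sum_j phi k (F i j) * ((v j : l2 R I) k : R[i])) *
    Num.conj ((v i : l2 R I) k : R[i])) '<\sum_j map_mx diag_map F i j (v j), v i>.
  have := l2_dotP (\sum_j map_mx diag_map F i j (v j)) (v i).
  congr (is_hsum _ _); apply/funext => k; congr (_ * _).
  by rewrite l2_sumE; apply: eq_bigr => j _; rewrite mxE diag_mapE.
apply: is_hsum_ge0 (is_hsum_sum h) _ => k.
rewrite (_ : \sum_i _ = \sum_i \sum_j phi k (F i j) * ((v j : l2 R I) k : R[i]) *
    Num.conj ((v i : l2 R I) k : R[i])).
  exact: (state_mxpos (fun j => (v j : l2 R I) k) (phi_state k) Fpos).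
by apply: eq_bigr => i _; rewrite mulr_suml.
Qed.

End DiagonalMap.

Section EvalRep.
Context {R : realType} {X : topologicalType} (X_compact : compact [set: X]).
Context {I : choiceType} (p : I -> X).
Implicit Types f g : C(X; R).

Definition eval_rep : C(X; R) -> B(l2_hilbert R I) :=
  diag_map X_compact (fun i => eval_state (p i)).

Lemma eval_repE f (x : l2_hilbert R I) i :
  (eval_rep f x : l2 R I) i = (f (p i) : R[i]) * ((x : l2 R I) i : R[i]).
Proof. by []. Qed.

Lemma eval_rep_star_rep : star_rep eval_rep.
Proof.
split; [exact: diag_map_linear | exact: diag_map1 | move=> f g | move=> f].
  apply/bopP => x; apply: l2P => i.
  by rewrite bop_mulE !eval_repE cfunE mulrA.
apply/esym/adj_eq => x y; apply: l2_dot_unique.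
have := l2_dotP x (eval_rep (cconj f) y); congr (is_hsum _ _); apply/funext => i.
rewrite !eval_repE cconjE rmorphM /= conjCK; ring.
Qed.

End EvalRep.

(** * Density of the Choquet points *)

Section Generated.
Context {R : realType} {A : lmodType R[i]}.
Context (mul : A -> A -> A) (star : A -> A) (nrm : A -> R).

Lemma cstar_generated_subalgebra (S : set A) :
  cstar_subalgebra mul star nrm (cstar_generated mul star nrm S).
Proof.
split.
- by move=> B [[B0 _ _ _ _] _].
- by move=> a x y Sx Sy B [sB SB]; have [_ h _ _ _] := sB; apply: h; [exact: Sx|exact: Sy].
- by move=> x y Sx Sy B [sB SB]; have [_ _ h _ _] := sB; apply: h; [exact: Sx|exact: Sy].
- by move=> x Sx B [sB SB]; have [_ _ _ h _] := sB; apply: h; exact: Sx.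
- move=> x Sx B [sB SB]; have [_ _ _ _ h] := sB; apply: h => e e0.
  by have [y Sy xy] := Sx e e0; exists y => //; exact: Sy.
Qed.

Lemma sub_cstar_generated (S : set A) : S `<=` cstar_generated mul star nrm S.
Proof. by move=> x Sx B [_ SB]; exact: SB. Qed.

Lemma cstar_generated_ind (S B : set A) : cstar_subalgebra mul star nrm B ->
  S `<=` B -> cstar_generated mul star nrm S `<=` B.
Proof. by move=> sB SB x; apply; split. Qed.

End Generated.

(** * Bump functions and separation of points *)

Section Bump.
Context {R : realType} {X : topologicalType}.
Context (X_compact : compact [set: X]) (X_hausdorff : hausdorff_space X).

Lemma bump_function (x : X) (U : set X) : nbhs x U -> exists h : X -> R,
  [/\ continuous h, h x = 1, forall y, ~ U y -> h y = 0 & forall y, 0 <= h y <= 1].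
Proof.
move=> xU; have cr := normal_completely_regular (compact_normal X_hausdorff X_compact)
  (hausdorff_accessible X_hausdorff).
have [||h [hc h01 hx hU]] := (@uniform_separatorP X R _ _).1 (@cr R x (~` U°) _ _).
- by apply: open_closedC; exact: open_interior.
- by rewrite /=; apply.
exists (fun y => 1 - h y); split.
- by move=> y; apply: (@cvgB R R^o); [exact: cvg_cst | exact: hc].
- by have -> : h x = 0; [apply: hx; exists x | rewrite subr0].
- move=> y nUy; have -> : h y = 1.
    by apply: hU; exists y => // /interior_subset.
  by rewrite subrr.
- move=> y; have : h y \in `[0, 1] by apply: h01; exists y.
  by rewrite in_itv /=; lra.
Qed.

End Bump.

Section FunctionSpace.
Context {R : realType} {X : topologicalType}.
Context (X_compact : compact [set: X]) (X_hausdorff : hausdorff_space X).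
Context (M : set C(X; R)) (M_gen : cstar_CX M = setT).
Implicit Types f g : C(X; R).

Lemma cfun_ind (P : set C(X; R)) :
  @cstar_subalgebra R C(X; R) *%R cconj supnorm P -> M `<=` P -> forall f, P f.
Proof.
move=> sP MP f; apply: (cstar_generated_ind sP MP).
by have : (cstar_CX M) f by rewrite M_gen.
Qed.

(** The functions with equal values at [y] and [z] form a closed self-adjoint subalgebra. If it
    contains [M] it is all of C(X), against Urysohn separation. *)
Lemma space_separates y z : (forall g, M g -> g y = g z) -> y = z.
Proof.
move=> Myz; have fyz f : f y = f z.
  apply: (@cfun_ind [set f | f y = f z]) => //; split=> /=.
  - by [].
  - move=> a g h gyz hyz; suff : (a *: g + h) y = (a *: g + h) z by [].
    by rewrite !cfunDE !cfunZE gyz hyz.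
  - by move=> g h gyz hyz; suff : (g * h) y = (g * h) z by []; rewrite !cfunME gyz hyz.
  - by move=> g gyz; suff : cconj g y = cconj g z by []; rewrite !cconjE gyz.
  move=> g gap; apply/eqP; rewrite -subr_eq0; apply/eqP/(@rnorm_eq0 R R[i]^o).
  apply/eqP; rewrite eq_le rnorm_ge0 andbT; apply/ler_addgt0Pr => e e0; rewrite add0r.
  have e2 : 0 < e / 2 by rewrite divr_gt0.
  have [h hyz gh] := gap _ e2.
  have -> : g y - g z = (g - h) y - (g - h) z.
    by rewrite !cfunE hyz; rewrite opprD opprK addrACA addNr addr0.
  apply: le_trans (rnormD _ _) _; rewrite rnormN (splitr e) lerD //.
    exact: le_trans (le_supnorm X_compact _ _) (ltW gh).
  exact: le_trans (le_supnorm X_compact _ _) (ltW gh).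
apply: contrapT => yz.
have [|h [hc hy hz _]] := @bump_function R X X_compact X_hausdorff y [set~ z].
  apply: open_nbhs_nbhs; split; last exact: yz.
  apply: closed_openC; apply: accessible_closed_set1.
  exact: hausdorff_accessible.
have := fyz (rfun hc); rewrite !rfunE hy hz; last by move=> /(_ erefl).
by move/complexI/eqP; rewrite oner_eq0.
Qed.

(** The preimage of a C*-algebra under the contractive [pi] is a closed self-adjoint subalgebra;
    containing [M], it is everything. *)
Lemma star_rep_generated (H : hilbertType R) (pi : C(X; R) -> B(H)) (S : set B(H)) :
  star_rep pi -> (forall g, M g -> cstar_BH S (pi g)) -> forall f, cstar_BH S (pi f).
Proof.
move=> pi_rep piM; have [S0 Slin Smul Sstar Scl] :=
  @cstar_generated_subalgebra R B(H) *%R adj opnorm S.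
apply: (@cfun_ind [set f | cstar_BH S (pi f)]) => //; split=> /=.
- by rewrite (star_rep0 pi_rep).
- by move=> a f g Sf Sg; rewrite (star_repD pi_rep) (star_repZ pi_rep); exact: Slin.
- by move=> f g Sf Sg; rewrite (star_repM pi_rep); exact: Smul.
- by move=> f Sf; have [_ _ _ ->] := pi_rep; exact: Sstar.
- move=> f fap; apply: Scl => e e0; have [g Sg fg] := fap e e0.
  exists (pi g) => //; rewrite -(star_repB pi_rep).
  exact: le_lt_trans (opnorm_star_rep X_compact pi_rep _) fg.
Qed.

(* A *-homomorphism of C(X) is positive, hence contractive, hence determined by
   its values on M. *)
Lemma star_hom_id (sigma : C(X; R) -> C(X; R)) :
  (forall a f g, sigma (a *: f + g) = a *: sigma f + sigma g) ->
  (forall f g, sigma (f * g) = sigma f * sigma g) ->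
  (forall f, sigma (cconj f) = cconj (sigma f)) -> sigma 1 = 1 ->
  (forall g, M g -> sigma g = g) -> forall f, sigma f = f.
Proof.
move=> slin smul sstar s1 sM.
have sD f g : sigma (f + g) = sigma f + sigma g.
  by have := slin 1 f g; rewrite !scale1r.
have s0 : sigma 0 = 0 by apply: (addrI (sigma 0)); rewrite -sD !addr0.
have sZ a f : sigma (a *: f) = a *: sigma f.
  by have := slin a f 0; rewrite s0 !addr0.
have sB f g : sigma (f - g) = sigma f - sigma g.
  by rewrite sD -scaleN1r sZ scaleN1r.
have spos f : cpos f -> cpos (sigma f).
  move=> /cpos_sqrt[r rr <-]; rewrite smul -{1}rr sstar; exact: cpos_modsq.
have sle f x : rnorm (sigma f x) <= supnorm f.
  have := spos _ (cpos_supnorm_modsq X_compact f) x.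
  rewrite sB sZ s1 smul sstar !cfunE mulr1 subr_ge0 mulrC -normCK.
  by rewrite -(@rnormE R R[i]^o) -rmorphXn lecR ler_sqr ?nnegrE ?rnorm_ge0 ?supnorm_ge0.
apply: (@cfun_ind [set f | sigma f = f]) => //; split=> //=.
- by move=> a f g sf sg; rewrite slin sf sg.
- by move=> f g sf sg; rewrite smul sf sg.
- by move=> f sf; rewrite sstar sf.
move=> f fap; apply: cfunP => x; apply/eqP; rewrite -subr_eq0.
apply/eqP/(@rnorm_eq0 R R[i]^o); apply/eqP; rewrite eq_le rnorm_ge0 andbT.
apply/ler_addgt0Pr => e e0; rewrite add0r.
have e2 : 0 < e / 2 by rewrite divr_gt0.
have [g sg fg] := fap _ e2.
have -> : sigma f x - f x = sigma (f - g) x - (f - g) x.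
  by rewrite sB !cfunE sg opprD opprK addrACA addNr addr0.
apply: le_trans (rnormD _ _) _; rewrite rnormN (splitr e) lerD //.
  exact: le_trans (sle _ _) (ltW fg).
exact: le_trans (le_supnorm X_compact _ _) (ltW fg).
Qed.

End FunctionSpace.

Section L2norm.
Context {R : realType} {V : normedModType R[i]} {n : nat}.
Implicit Types v : 'I_n -> V.

Lemma l2norm_ge0 v : 0 <= l2norm v.
Proof. exact: sqrtr_ge0. Qed.

Lemma l2norm_sqr v : l2norm v ^+ 2 = \sum_i rnorm (v i) ^+ 2.
Proof. by rewrite sqr_sqrtr // sumr_ge0 // => i _; exact: sqr_ge0. Qed.

Lemma rnorm_le_l2norm v i : rnorm (v i) <= l2norm v.
Proof.
rewrite -ler_sqr ?nnegrE ?rnorm_ge0 ?l2norm_ge0 // l2norm_sqr (bigD1 i) //=.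
by rewrite lerDl sumr_ge0 // => j _; exact: sqr_ge0.
Qed.

End L2norm.

Section Sup.
Context {R : realType}.

Lemma sup_nonneg (S : set R) : (forall r, S r -> 0 <= r) -> 0 <= sup S.
Proof.
move=> S0; have [hS|nS] := pselect (has_sup S); last by rewrite sup_out.
have [[r Sr] _] := hS; exact: le_trans (S0 r Sr) (sup_upper_bound hS Sr).
Qed.

End Sup.

(** * Evaluation on a norming set is completely isometric *)

Section Cover.
Context {R : realType} {X : topologicalType} (X_compact : compact [set: X]).
Context (M : set C(X; R)) (M_space : unital_function_space M).
Context {I : choiceType} (p : I -> X).
Hypothesis p_norming : forall g, M g -> forall x, exists k, fre g x <= fre g (p k).
Context {n : nat} (F : 'M[C(X; R)]_n).
Hypothesis F_M : forall i j, M (F i j).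

Let s := mxsupnorm F.
Let act (x : X) (v : 'I_n -> R[i]^o) (i : 'I_n) : R[i]^o :=
  \sum_j ((F i j x : R[i]) * v j : R[i]^o).

Lemma rnorm_sum (V : normedModType R[i]) (J : Type) (r : seq J) (u : J -> V) :
  rnorm (\sum_(j <- r) u j) <= \sum_(j <- r) rnorm (u j).
Proof.
elim: r => [|j r IHr]; first by rewrite !big_nil rnorm0.
by rewrite !big_cons; apply: le_trans (rnormD _ _) _; rewrite lerD2l.
Qed.

Let act_le x v : l2norm v <= 1 -> l2norm (act x v) <= s.
Proof.
move=> v1; apply: ub_le_sup; last by exists x, v.
exists (Num.sqrt (\sum_i (\sum_j supnorm (F i j)) ^+ 2)) => _ [y [w [w1 ->]]].
apply: ler_wsqrtr; apply: ler_sum => i _.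
rewrite ler_sqr ?nnegrE ?rnorm_ge0 ?sumr_ge0 //; last by move=> j _; exact: supnorm_ge0.
apply: le_trans (rnorm_sum _ _) _; apply: ler_sum => j _.
rewrite -[F i j y * w j]/((F i j y : R[i]) *: w j) rnormZ.
rewrite -[leRHS]mulr1 ler_pM ?rnorm_ge0 ?le_supnorm //.
exact: le_trans (rnorm_le_l2norm w j) w1.
Qed.

Let s_ge0 : 0 <= s.
Proof. by apply: sup_nonneg => _ [x [v [_ ->]]]; exact: l2norm_ge0. Qed.

Let act_sqr_le x v : \sum_i rnorm (act x v i) ^+ 2 <= s ^+ 2 * \sum_j rnorm (v j) ^+ 2.
Proof.
rewrite -!l2norm_sqr -exprMn ler_sqr ?nnegrE ?mulr_ge0 ?l2norm_ge0 //.
have [v0|v0] := eqVneq (l2norm v) 0.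
  rewrite v0 mulr0 /l2norm big1 ?sqrtr0 // => i _.
  rewrite /act big1 ?rnorm0 ?expr0n // => j _.
  have -> : v j = 0; last by rewrite mulr0.
  by apply: rnorm_eq0; apply/eqP; rewrite eq_le rnorm_ge0 andbT -v0 rnorm_le_l2norm.
pose N := l2norm v; have N0 : 0 < N by rewrite lt_def v0 l2norm_ge0.
have l2normZ (a : R) (u : 'I_n -> R[i]^o) : 0 <= a ->
    l2norm (fun i => a%:C *: u i) = a * l2norm u.
  move=> a0; apply/eqP; rewrite -(@eqrXn2 _ 2) ?mulr_ge0 ?l2norm_ge0 //.
  rewrite exprMn !l2norm_sqr mulr_sumr; apply/eqP/eq_bigr => i _.
  by rewrite rnormZ rnormC exprMn ger0_norm.
have h : l2norm (fun j => (N^-1)%:C *: v j) <= 1.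
  by rewrite l2normZ ?invr_ge0 ?(ltW N0) // -/N mulVf ?gt_eqF.
have := act_le x h.
have -> : act x (fun j => (N^-1)%:C *: v j) = fun i => (N^-1)%:C *: act x v i.
  apply/funext => i; rewrite /act scaler_sumr; apply: eq_bigr => j _.
  by rewrite -[_ *: v j]/(_ * _) -[RHS]/(_ * _); rewrite mulrCA.
by rewrite l2normZ ?invr_ge0 ?(ltW N0) // ler_pdivrMl // mulrC.
Qed.

Let T := map_mx (eval_rep X_compact p) F.

Let opact (v : 'I_n -> l2_hilbert R I) i := \sum_j T i j (v j).

Let opactE v i k : (opact v i : l2 R I) k = act (p k) (fun j => (v j : l2 R I) k) i.
Proof. by rewrite l2_sumE; apply: eq_bigr => j _; rewrite mxE eval_repE. Qed.

Let hsum_rnorm m (v : 'I_m -> l2_hilbert R I) :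
  is_hsum (fun k => (\sum_i rnorm ((v i : l2 R I) k) ^+ 2)%:C) (l2norm v ^+ 2)%:C.
Proof.
rewrite l2norm_sqr rmorph_sum /=.
have h i : is_hsum (fun k => (rnorm ((v i : l2 R I) k) ^+ 2)%:C) (rnorm (v i) ^+ 2)%:C.
  rewrite l2_rnormE; have := l2_dotP (v i) (v i); congr (is_hsum _ _).
  by apply/funext => k; rewrite rnorm_sqrE.
have := is_hsum_sum h; congr (is_hsum _ _).
by apply/funext => k; rewrite rmorph_sum.
Qed.

Let opact_le v : l2norm v <= 1 -> l2norm (opact v) <= s.
Proof.
move=> v1; suff : l2norm (opact v) ^+ 2 <= s ^+ 2 * l2norm v ^+ 2.
  rewrite -exprMn ler_sqr ?nnegrE ?mulr_ge0 ?l2norm_ge0 // => /le_trans; apply.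
  by rewrite ler_piMr.
rewrite -subr_ge0 -ler0c rmorphB rmorphM /=.
have := is_hsumD (is_hsumZ (s ^+ 2)%:C (@hsum_rnorm _ v))
  (is_hsumZ (-1) (@hsum_rnorm _ (opact v))).
rewrite mulN1r => /is_hsum_ge0; apply => k.
rewrite mulN1r -rmorphM -rmorphB ler0c subr_ge0.
under eq_bigr do rewrite opactE.
exact: act_sqr_le.
Qed.

(** The upper bound sums a pointwise estimate over the coordinates. For the lower bound, a vector
    [eta = F(x) v] is matched at some [p k] with a vector [F(p k) v] at least as long, and [T]
    produces the latter on the basis vector at [k]. *)
Lemma eval_rep_mxopnorm : mxopnorm T = s.
Proof.
apply/eqP; rewrite eq_le; apply/andP; split.
  apply: ge_sup; last by move=> _ [v /= v1 <-]; exact: opact_le.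
  exists (l2norm (opact (fun=> 0))); exists (fun=> 0) => //=.
  by rewrite /l2norm big1 ?sqrtr0 // => i _; rewrite rnorm0 expr0n.
have le_op v : l2norm v <= 1 -> l2norm (opact v) <= mxopnorm T.
  move=> v1; apply: ub_le_sup; last by exists v.
  by exists s => _ [w /= w1 <-]; exact: opact_le.
have op0 : 0 <= mxopnorm T.
  by apply: sup_nonneg => _ [v _ <-]; exact: l2norm_ge0.
(* The set is empty only for empty [X], as [v = 0] is always admissible; its [sup] is then 0. *)
have [h|h] := pselect ([set r | exists x (v : 'I_n -> R[i]^o), l2norm v <= 1 /\
    r = l2norm (fun i => \sum_j (F i j x * v j : R[i]^o))] !=set0); last first.
  rewrite /s /mxsupnorm (_ : [set _ | _] = set0) ?sup0 //.
  by rewrite -subset0 => r hr; apply: h; exists r.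
apply: ge_sup => // _ [x [v [v1 ->]]].
pose eta i := act x v i.
(* Pairing [F v] with the fixed vector [eta] yields a scalar function in [M] whose value at [x] is
   [l2norm eta ^+ 2], so the norming hypothesis applies to it. *)
pose g := \sum_i \sum_j (Num.conj (eta i : R[i]) * (v j : R[i])) *: F i j.
have gE y : (g y : R[i]) = \sum_i Num.conj (eta i : R[i]) * (act y v i : R[i]).
  rewrite cfun_sumE; apply: eq_bigr => i _; rewrite cfun_sumE mulr_sumr.
  by apply: eq_bigr => j _; rewrite cfunZE; ring.
have Mg : M g.
  apply: big_ind => [||i _]; [exact: space0|exact: spaceD|].
  by apply: big_ind => [||j _]; [exact: space0|exact: spaceD|exact: spaceZ].
have [k gk] := p_norming Mg x.
have gx : (g x : R[i]) = (l2norm eta ^+ 2)%:C.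
  rewrite gE l2norm_sqr rmorph_sum /=; apply: eq_bigr => i _.
  by rewrite rnorm_sqrE mulrC.
pose zeta i := act (p k) v i.
have eta_zeta : l2norm eta <= l2norm zeta.
  rewrite -ler_sqr ?nnegrE ?l2norm_ge0 //.
  (* Expanding this square and using [fre g (p k) >= l2norm eta ^+ 2] gives the comparison. *)
  have : 0 <= \sum_i rnorm (eta i - zeta i) ^+ 2 by apply: sumr_ge0 => i _; exact: sqr_ge0.
  have -> : \sum_i rnorm (eta i - zeta i) ^+ 2 =
      l2norm eta ^+ 2 - 2 * fre g (p k) + l2norm zeta ^+ 2.
    rewrite /fre gE !l2norm_sqr (raddf_sum (@complex.Re R : Rcomplex R -> R)) mulr_sumr.
    rewrite -sumrB -big_split /=; apply: eq_bigr => i _.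
    rewrite -/(zeta i) /rnorm !normc_def /= !sqr_sqrtr ?addr_ge0 ?sqr_ge0 //.
    by case: (eta i) (zeta i) => a b [c d] /=; ring.
  by move: gk; rewrite {1}/fre gx /=; lra.
apply: le_trans eta_zeta _.
pose w (j : 'I_n) : l2_hilbert R I := (v j : R[i]) *: l2_basis k.
have l2norm_basis (u : 'I_n -> R[i]^o) :
    l2norm (fun i => (u i : R[i]) *: (l2_basis k : l2_hilbert R I)) = l2norm u.
  by congr Num.sqrt; apply: eq_bigr => i _; rewrite rnormZ rnorm_l2_basis mulr1.
rewrite -(l2norm_basis zeta).
have <- : opact w = fun i => (zeta i : R[i]) *: (l2_basis k : l2_hilbert R I).
  apply/funext => i; apply: l2P => j; rewrite opactE.
  rewrite -[RHS]/((zeta i : R[i]) * (j == k)%:R) /zeta /act mulr_suml.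
  apply: eq_bigr => m _; rewrite -[w m j]/((v m : R[i]) * (j == k)%:R).
  by have [->|_] := eqVneq j k; rewrite ?mulr1 // !mulr0.
by apply: le_op; rewrite /w l2norm_basis.
Qed.

End Cover.

(** * Application of the envelope property *)

Section Density.
Context {R : realType} {X : topologicalType}.
Context (X_compact : compact [set: X]) (X_hausdorff : hausdorff_space X).
Context (M : set C(X; R)) (M_space : unital_function_space M).
Hypothesis M_envelope : is_cstar_envelope M.

(** Evaluation at the Choquet points is a C*-cover. The map [theta] of the envelope composed with
    [pi] fixes [M], hence is the identity, so [pi] is injective. A bump function supported away from
    the Choquet points would lie in its kernel. *)
Lemma choquet_dense (x : X) (U : set X) : nbhs x U -> exists2 y, choquet M y & U y.
Proof.
move=> xU; have [M_gen env] := M_envelope.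
have Msep := space_separates X_compact X_hausdorff M_gen.
pose p (k : set_type (choquet M)) : X := val k.
have p_norming g : M g -> forall z, exists k, fre g z <= fre g (p k).
  move=> Mg z; have [y yCh gy] := choquet_max X_compact M_space z Msep Mg.
  by exists (SigSub (mem_set yCh)).
pose pi : C(X; R) -> _ := eval_rep X_compact p.
have pi_rep : star_rep pi := eval_rep_star_rep X_compact p.
have cover : cstar_cover M pi.
  split=> [a f g _ _||n F FM].
  - by rewrite (star_repD pi_rep) (star_repZ pi_rep).
  - exact: star_rep1.
  - exact: (eval_rep_mxopnorm X_compact M_space p_norming FM).
have [theta [theta_lin theta_mul theta_star] theta_M] := env _ _ cover.
have pi_gen f : cstar_BH (pi @` M) (pi f).
  apply: (star_rep_generated X_compact M_gen) => // g Mg.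
  by apply: sub_cstar_generated; exists g.
have theta_pi f : theta (pi f) = f.
  apply: (@star_hom_id _ _ X_compact _ M_gen (theta \o pi)) => //=.
  - by move=> a g h; rewrite (star_repD pi_rep) (star_repZ pi_rep) theta_lin.
  - by move=> g h; rewrite (star_repM pi_rep) theta_mul.
  - by move=> g; have [_ _ _ ->] := pi_rep; rewrite theta_star.
  - by apply: theta_M; exact: M_space.1.
apply: contrapT => nU.
have [h [hc hx hU _]] := @bump_function R X X_compact X_hausdorff x U xU.
have pih : pi (rfun hc) = pi 0.
  apply/bopP => v; apply: l2P => k; rewrite !eval_repE rfunE hU // => Uk.
  by apply: nU; exists (p k) => //; exact: set_mem (valP k).
have := congr1 (fun f : C(X; R) => (f x : R[i])) (theta_pi (rfun hc)).
rewrite pih theta_pi rfunE hx cfun0E => /(@complexI R)/eqP.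
by rewrite eq_sym oner_eq0.
Qed.

End Density.

(** * The implications *)

Section NeighbourhoodNet.
Context {X : topologicalType} (x : X).

Let nb := {U : set X | nbhs x U}.
Let nb_le (U V : nb) := sval V `<=` sval U.

Definition nbhs_directed : directedType.
Proof.
refine (@Directed nb nb_le (inhabits (exist _ setT filterT)) _ _ _).
- by move=> U.
- by move=> U V W UV VW; exact: subset_trans VW UV.
- move=> [U xU] [V xV]; exists (exist _ (U `&` V) (filterI xU xV)).
  by split=> y [].
Defined.

Lemma cvg_nbhs_directed (V : topologicalType) (f : X -> V) (y : nbhs_directed -> X) :
  (forall U : nbhs_directed, sval (U : nb) (y U)) -> {for x, continuous f} ->
  f (y U) @[U --> tails nbhs_directed] --> f x.
Proof.
move=> yU fx A /fx xA.
exists (exist (fun U => nbhs x U) (f @^-1` A) xA) => U UA.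
exact: UA (yU U).
Qed.

End NeighbourhoodNet.

#[global] Instance tails_filter (D : directedType) : ProperFilter (tails D).
Proof.
split; first by move=> [a /(_ a (dle_refl a))].
split.
- by have [a] := dle_inh D; exists a.
- move=> P Q [a aP] [b bQ]; have [c [ac bc]] := dle_ub a b.
  by exists c => d cd; split; [apply: aP | apply: bQ]; apply: dle_trans cd.
- by move=> P Q PQ [a aP]; exists a => b ab; exact/PQ/aP.
Qed.

(** * Choquet points and Korovkin convergence *)

Section Korovkin.
Context {R : realType} {X : topologicalType}.
Context (X_compact : compact [set: X]) (X_hausdorff : hausdorff_space X).
Context (M : set C(X; R)) (M_space : unital_function_space M).
Implicit Types f g : C(X; R).

Lemma ucp_CX_state (psi : C(X; R) -> C(X; R)) x : ucp_CX psi ->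
  state (fun f => psi f x).
Proof.
move=> [lin one pos]; split=> [a f g||f f0].
- by rewrite lin.
- by rewrite one.
by have := pos _ _ (mxpos_const f0) x (fun=> 1); rewrite !big_ord1 !mxE rmorph1 !mulr1.
Qed.

(** Near [x], a majorant [g] of [f] gives [psi a f <= psi a g < g + e / 2 < f + e] in real parts,
    eventually in [a]; compactness makes this uniform. Applying it to [- f] gives the lower bound,
    and to [i f] the imaginary part. *)
Lemma choquet_Korovkin : (forall x, choquet M x) ->
  forall (D : directedType) (psi : D -> C(X; R) -> C(X; R)),
  (forall a, ucp_CX (psi a)) ->
  (forall g, M g -> supnorm (psi a g - g) @[a --> tails D] --> (0 : R)) ->
  forall f, supnorm (psi a f - f) @[a --> tails D] --> (0 : R).
Proof.
move=> allCh D psi psi_ucp psiM.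
have upper f (e : R) : 0 < e ->
    \forall a \near tails D, forall x, fre (psi a f) x < fre f x + e.
  move=> e0; have e2 : 0 < e / 2 by rewrite divr_gt0.
  pose P (U : set X) := \forall a \near tails D,
    forall x, U x -> fre (psi a f) x < fre f x + e.
  suff : P setT by rewrite /P; apply: filterS => a h x; exact: h.
  apply: compact_induction => //.
  - by apply: nearW.
  - by move=> A B AB; rewrite /P; apply: filterS => a h x /AB; exact: h.
  - by move=> A B; rewrite /P; apply: filterS2 => a hA hB x [/hA|/hB].
  - move=> x; have [g [Mg fg gx]] := choquet_majorant X_compact M_space f (allCh x) e2.
    exists [set y | fre g y - fre f y < e / 2].
      have : (fun y => fre g y - fre f y) @ x --> fre g x - fre f x.
        by apply: (@cvgB R R^o); exact: continuous_fre.
      by move/(@cvgr_lt R); apply; lra.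
    have psig := (@cvgrPdist_lt R R^o _ _ _ _ _).1 (psiM g Mg) _ e2.
    have [a0 ha0] := psig; exists a0 => a /ha0 /=.
    rewrite sub0r normrN ger0_norm ?supnorm_ge0 // => ag y /= gy.
    have := state_le (ucp_CX_state y (psi_ucp a)) X_compact fg.
    rewrite -/(fre (psi a f) y) -/(fre (psi a g) y).
    have := le_lt_trans (ler_fre_supnorm X_compact (psi a g - g) y) ag.
    by rewrite freB ltr_norml => /andP[]; lra.
have psiZ a c f : psi a (c *: f) = c *: psi a f.
  by apply: cfunP => x; rewrite (stateZ (ucp_CX_state x (psi_ucp a))).
have close f (e : R) : 0 < e ->
    \forall a \near tails D, forall x, `|fre (psi a f) x - fre f x| < e.
  move=> e0; apply: filterS2 (upper f e e0) (upper (- f) e e0) => a h1 h2 x.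
  have h1x := h1 x; have h2x := h2 x.
  rewrite -(scaleN1r f) psiZ !scaleN1r !freN in h2x.
  by rewrite ltr_norml; apply/andP; split; lra.
move=> f; apply/(@cvgrPdist_le R R^o) => e e0.
have e2 : 0 < e / 2 by rewrite divr_gt0.
apply: filterS2 (close f _ e2) (close ('i%C *: f) _ e2) => a h1 h2.
rewrite sub0r normrN ger0_norm ?supnorm_ge0 //; apply: supnorm_le; first exact: ltW.
move=> x; apply: le_trans (rnorm_le_Re_Im _) _.
rewrite -[X in X <= _]/(`|fre (psi a f - f) x| + `|fim (psi a f - f) x|).
rewrite -[fim _ _]opprK -fre_i normrN scalerBr -psiZ !freB (splitr e).
by rewrite lerD // ltW.
Qed.

End Korovkin.

Section KorovkinConverse.
Context {R : realType} {X : topologicalType}.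
Context (X_compact : compact [set: X]) (X_hausdorff : hausdorff_space X).
Context (M : set C(X; R)) (M_space : unital_function_space M).
Implicit Types f g q : C(X; R).

(** At each point [y] the image of a positive [F] is a convex combination of the positive matrices
    [F(y)] and [phi(F)]. *)
Lemma ucp_CX_mix (phi : C(X; R) -> R[i]) (h : X -> R) (hc : continuous h) :
  state phi -> (forall y, 0 <= h y <= 1) ->
  ucp_CX (fun f => (1 - rfun hc) * f + phi f *: rfun hc).
Proof.
move=> sphi h01; split=> [a f g||n F Fpos y v].
- apply: cfunP => y; rewrite !cfunE stateD // stateZ //; ring.
- have [_ -> _] := sphi; apply: cfunP => y; rewrite !cfunE; ring.
rewrite (_ : \sum_i _ =
   (1 - h y)%:C * \sum_i \sum_j (F i j y : R[i]) * v j * Num.conj (v i) +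
   (h y)%:C * \sum_i \sum_j phi (F i j) * v j * Num.conj (v i)).
  have /andP[h0 h1] := h01 y.
  by apply: addr_ge0; apply: mulr_ge0; rewrite ?ler0c ?subr_ge0 //;
    exact: state_mxpos.
rewrite !mulr_sumr -big_split /=; apply: eq_bigr => i _.
rewrite !mulr_sumr -big_split /=; apply: eq_bigr => j _.
rewrite mxE !cfunE rfunE rmorphB; ring.
Qed.

(* Move the point mass at x towards a representing state phi by means of
   f |-> (1 - h) f + phi(f) h, with h a bump function shrinking to x. *)
Lemma Korovkin_choquet :
  (forall (D : directedType) (psi : D -> C(X; R) -> C(X; R)),
    (forall a, ucp_CX (psi a)) ->
    (forall g, M g -> supnorm (psi a g - g) @[a --> tails D] --> (0 : R)) ->
    forall f, supnorm (psi a f - f) @[a --> tails D] --> (0 : R)) ->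
  forall x, choquet M x.
Proof.
move=> korovkin x phi sphi phiM f.
pose D := nbhs_directed x.
have /choice[h hP] (U : D) : exists h : {h : X -> R | continuous h},
    [/\ sval h x = 1, forall y, ~ sval (U : {U : set X | nbhs x U}) y -> sval h y = 0
      & forall y, 0 <= sval h y <= 1].
  have [h [hc h1 h0 h01]] := @bump_function R X X_compact X_hausdorff x _
    (svalP (U : {U : set X | nbhs x U})).
  by exists (exist _ h hc).
pose psi (U : D) g := (1 - rfun (svalP (h U))) * g + phi g *: rfun (svalP (h U)).
have psi_ucp U : ucp_CX (psi U) by apply: ucp_CX_mix => //; case: (hP U).
(* For [g] in [M] one has [phi g = g x], which is close to [g y] on [U], while [h] vanishes off [U].
   At [y = x], where [h = 1], the difference is exactly [phi f - f x]. *)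
have psiE U g y : psi U g y - g y = (sval (h U) y)%:C * (phi g - (g y : R[i])).
  by rewrite /psi !cfunE rfunE; ring.
have psiM g : M g -> supnorm (psi U g - g) @[U --> tails D] --> (0 : R).
  move=> Mg; apply/(@cvgrPdist_le R R^o) => e e0.
  have xU := @near_rnorm _ R[i]^o (g x) _ e0.
  have {}xU : nbhs x [set y | rnorm (g x - g y) < e] by exact: (@cts_fun _ _ g x _ xU).
  exists (exist (fun U => nbhs x U) _ xU) => U UV.
  rewrite sub0r normrN ger0_norm ?supnorm_ge0 //; apply: supnorm_le; first exact: ltW.
  move=> y; rewrite !cfunE psiE phiM //.
  have [_ h0 h01] := hP U.
  have [Uy|nUy] := pselect (sval (U : {U : set X | nbhs x U}) y); last first.
    by rewrite h0 // mul0r rnorm0 ltW.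
  rewrite -[_ * _]/(_ *: (g x - g y : R[i]^o)) rnormZ rnormC.
  have /andP[hy0 hy1] := h01 y; rewrite ger0_norm //.
  apply: le_trans (_ : 1 * rnorm (g x - g y) <= _); first by rewrite ler_wpM2r ?rnorm_ge0.
  by rewrite mul1r ltW //; exact: (UV y Uy).
have := korovkin D psi psi_ucp psiM f.
move/(@cvgrPdist_le R R^o) => psif.
apply/eqP; rewrite -subr_eq0; apply/eqP/(@rnorm_eq0 R R[i]^o).
apply/eqP; rewrite eq_le rnorm_ge0 andbT; apply/ler_addgt0Pr => e e0; rewrite add0r.
have [U UP] := psif e e0; have /= := UP U (dle_refl U).
rewrite sub0r normrN ger0_norm ?supnorm_ge0 //; apply: le_trans.
apply: le_trans (le_supnorm X_compact (psi U f - f) x).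
by rewrite !cfunE psiE; have [-> _ _] := hP U; rewrite mul1r.
Qed.

End KorovkinConverse.

Section Approximation.
Context {R : realType}.

Lemma complex_ge0_eps (z c : R[i]) : 0 <= c ->
  (forall e : R, 0 < e -> 0 <= z + e%:C * c) -> 0 <= z.
Proof.
case: z => a b; case: c => c d; rewrite lecE /= => /andP[/eqP -> c0] h.
have he (e : R) : 0 < e -> b = 0 /\ 0 <= a + e * c.
  move=> /h; rewrite lecE /= !mul0r !mulr0 subr0 !addr0 => /andP[/eqP -> ?].
  by split.
rewrite lecE /=; have [-> _] := he 1 ltr01; rewrite eqxx /=.
rewrite leNgt; apply/negP => a0.
(* This choice makes [e * c < - a]; the [+ 1] avoids division by 0. *)
have e0 : 0 < - a / (2 * (c + 1)) by rewrite divr_gt0 ?oppr_gt0 //; lra.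
have [_] := he _ e0.
have c1 : 0 < 2 * (c + 1) by lra.
have : c / (2 * (c + 1)) < 1 by rewrite ltr_pdivrMr //; lra.
have -> : - a / (2 * (c + 1)) * c = - a * (c / (2 * (c + 1))) by rewrite mulrAC mulrA.
by nra.
Qed.

Lemma continuous_maxr0 (X : topologicalType) (k : X -> R) :
  continuous k -> continuous (fun y => Num.max (k y) 0).
Proof.
move=> kc y; apply: (@continuous_max R X k (fun=> 0)); first exact: kc.
exact: cvg_cst.
Qed.

End Approximation.

(** * Boundary representations and extensions with commutative range *)

Section Boundary.
Context {R : realType} {X : topologicalType}.
Context (X_compact : compact [set: X]).
Context (M : set C(X; R)) (M_space : unital_function_space M).
Implicit Types f g q : C(X; R).

(** The normalised vector [w] gives a state that agrees with evaluation at [x] on [M], hence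
    everywhere, and [ucp_eigenvector] applies. *)
Lemma choquet_eigenvector (H : hilbertType R) (psi : C(X; R) -> B(H)) (v : H) x :
  choquet M x -> ucp psi -> (forall g, M g -> psi g v = (g x : R[i]) *: v) ->
  forall f, psi f v = (f x : R[i]) *: v.
Proof.
move=> xCh psi_ucp psiM; have [->|v0] := eqVneq v 0.
  by move=> f; rewrite bop0 scaler0.
have vv : '<v, v> != 0 by apply: contra_neq v0; exact: inner_eq0.
have N0 : rnorm v != 0 by apply: contra_neq v0; exact: rnorm_eq0.
have [w [vw wv w1]] : exists w : H, [/\ v = (rnorm v)%:C *: w,
    w = ((rnorm v)^-1)%:C *: v & '<w, w> = 1].
  exists (((rnorm v)^-1)%:C *: v); split=> //.
    by rewrite scalerA -rmorphM mulfV // scale1r.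
  rewrite innerZl innerZr inner_rnorm (_ : Num.conj _ = ((rnorm v)^-1)%:C);
    last exact: conjc_real.
  by rewrite -!rmorphM expr2 mulKf // mulVf.
have wx := xCh _ (ucp_state psi_ucp w1).
have {}wx f : '<psi f w, w> = (f x : R[i]).
  apply: wx => g Mg.
  by rewrite [in psi g w]wv bopZ psiM // scalerA mulrC -scalerA -wv innerZl w1 mulr1.
move=> f; rewrite vw bopZ (ucp_eigenvector X_compact psi_ucp f (x := x)).
  by rewrite !scalerA mulrC.
by move=> g; rewrite wx w1 mulr1.
Qed.

(* A nonzero [pi q] with [q >= 0] localises pi; irreducibility concentrates it
   at one point, since the kernel of each [pi g] is an invariant subspace. *)
Lemma irreducible_eval (H : hilbertType R) (pi : C(X; R) -> B(H)) :
  star_rep pi -> irreducible pi -> exists x, forall f, pi f = (f x : R[i]) *: (1 : B(H)).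
Proof.
move=> pi_rep [[v0 v0_neq0] pi_irr].
have piC f g v : pi f (pi g v) = pi g (pi f v).
  by rewrite -!bop_mulE -!(star_repM pi_rep) mulrC.
(* The kernel of [pi g] is closed and invariant, so it is 0 or everything. In the first case
   [pi g (pi f v) = 0] forces [pi f = 0]. *)
have pi_prime f g : f * g = 0 -> pi f = 0 \/ pi g = 0.
  move=> fg; have [|V0|VT] := pi_irr [set v | pi g v = 0].
  - split=> /=.
    + exact: bop0.
    + by move=> a u v gu gv; rewrite bopD bopZ gu gv scaler0 addr0.
    + apply: (@preimage_closed _ _ (pi g) [set 0]); last first.
        apply: accessible_closed_set1; apply: hausdorff_accessible.
        exact: norm_hausdorff.
      by move=> v _; exact: bop_continuous.
    + by move=> f' v gv; rewrite piC gv bop0.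
  - left; apply/bopP => v.
    have : [set v | pi g v = 0] (pi f v).
      by rewrite /= piC -bop_mulE -(star_repM pi_rep) fg (star_rep0 pi_rep).
    by rewrite V0.
  - right; apply/bopP => v; have : [set: H] v by [].
    by rewrite -VT.
(* Some [x] lies in the support of [pi]: otherwise compactness produces a strictly positive [q] with
   [pi q = 0], although [q] is invertible. *)
have [x xP] : exists x, forall q, cpos q -> 0 < fre q x -> pi q <> 0.
  apply: contrapT => nx.
  pose P (U : set X) := exists q, [/\ cpos q, forall y, U y -> 0 < fre q y & pi q = 0].
  have [q [qpos q0 piq]] : P setT.
    apply: compact_induction => //.
    - by exists 0; split=> //; exact: star_rep0.
    - by move=> A B AB [q [? qB ?]]; exists q; split=> // y /AB; exact: qB.
    - move=> A B [q [q0 qA piq]] [r [r0 rB pir]]; exists (q + r); split.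
      + by move=> y; rewrite cfunE addr_ge0.
      + move=> y AB; rewrite freD.
        have := cpos_fre y q0; have := cpos_fre y r0.
        by case: AB => [/qA|/rB]; lra.
      + by rewrite (star_repD pi_rep) piq pir addr0.
    - move=> x; have [q [q0 qx piq]] : exists q, [/\ cpos q, 0 < fre q x & pi q = 0].
        apply: contrapT => nq; apply: nx; exists x => q q0 qx piq.
        by apply: nq; exists q.
      exists [set y | 0 < fre q y]; last by exists q.
      exact: (@cvgr_gt R _ _ _ _ _ (@continuous_fre _ _ q x) 0 qx).
  have ci : continuous (fun y => (fre q y)^-1).
    by move=> y; apply: (@cvgV R); [rewrite gt_eqF // q0 | exact: continuous_fre].
  have qi : rfun (@continuous_fre _ _ q) * rfun ci = 1.
    by apply: cfunP => y; rewrite !cfunE !rfunE -rmorphM mulfV ?gt_eqF // q0.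
  have qre : rfun (@continuous_fre _ _ q) = q.
    by apply: cfunP => y; rewrite rfunE; exact/esym/ger0_complexE/qpos.
  move/eqP: v0_neq0; apply.
  rewrite -(bop_oneE v0) -(star_rep1 pi_rep) -qi (star_repM pi_rep) qre piq.
  by rewrite mul0r bop_zeroE.
have pi0 g : g x = 0 -> pi g = 0.
  move=> gx; apply/bopP => v; apply: inner_eq0; rewrite star_rep_modsq //.
  apply/eqP; rewrite eq_le; apply/andP; split; last exact/star_rep_ge0/cpos_modsq.
  set h := cconj g * g; have h0 : cpos h := cpos_modsq g.
  have hx : fre h x = 0 by rewrite /fre cfunME gx mulr0.
  rewrite -oppr_ge0; apply: (@complex_ge0_eps _ _ '<v, v>) => [|e e0].
    exact: inner_ge0.
  (* The positive parts of [e - h] and [h - e] have product 0. The first is positive at [x] and so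
     is not killed by [pi]; hence the second is, and [pi h <= e]. *)
  pose k1 y := e - fre h y; pose k2 y := fre h y - e.
  have k1c : continuous k1.
    by move=> y; apply: (@cvgB R R^o); [exact: cvg_cst | exact: continuous_fre].
  have k2c : continuous k2.
    by move=> y; apply: (@cvgB R R^o); [exact: continuous_fre | exact: cvg_cst].
  pose q1 := rfun (continuous_maxr0 k1c); pose q2 := rfun (continuous_maxr0 k2c).
  have q1pos : cpos q1 by move=> y; rewrite rfunE ler0c le_max lexx orbT.
  have q12 : q1 * q2 = 0.
    apply: cfunP => y; rewrite !cfunE !rfunE -rmorphM /k1 /k2 /=.
    have [hy|/ltW hy] := leP (fre h y) e.
      by rewrite [X in _ * X]max_r ?mulr0 // subr_le0.
    by rewrite [X in X * _]max_r ?mul0r // subr_le0.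
  have piq2 : pi q2 = 0.
    have [|//] := pi_prime _ _ q12 => /(xP q1 q1pos); case.
    by rewrite /fre rfunE /= /k1 hx subr0 lt_max e0.
  have hE : h = e%:C *: (1 : C(X; R)) - q1 + q2.
    apply: cfunP => y; rewrite (_ : h y = (fre h y)%:C); last exact: ger0_complexE.
    rewrite !cfunE !rfunE mulr1 -rmorphB -rmorphD /k1 /k2 /=; congr (_%:C).
    have [hy|/ltW hy] := leP (fre h y) e.
      by rewrite max_l ?subr_ge0 // max_r ?subr_le0 //; lra.
    by rewrite max_r ?subr_le0 // max_l ?subr_ge0 //; lra.
  rewrite hE (star_repD pi_rep) piq2 addr0 (star_repB pi_rep) (star_repZ pi_rep).
  rewrite (star_rep1 pi_rep) !bopE innerDl innerNl innerZl opprB subrK.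
  exact: star_rep_ge0.
exists x => f; apply/eqP; rewrite -subr_eq0; apply/eqP.
rewrite -(star_rep1 pi_rep) -(star_repZ pi_rep) -(star_repB pi_rep); apply: pi0.
by rewrite !cfunE mulr1 subrr.
Qed.

Lemma choquet_boundary_rep : (forall x, choquet M x) ->
  forall (H : hilbertType R) (pi : C(X; R) -> B(H)),
  star_rep pi -> irreducible pi -> boundary_rep M pi.
Proof.
move=> allCh H pi pi_rep pi_irr; split=> // psi psi_ucp psiM.
have [x pix] := irreducible_eval pi_rep pi_irr.
apply/funext => f; apply/bopP => v; rewrite pix bopE.
by apply: (choquet_eigenvector (allCh x) psi_ucp) => g Mg; rewrite psiM // pix.
Qed.

(** On a one-dimensional space, evaluation at [x] is irreducible, and [phi] acting by scalars
    extends its restriction to [M]. Unique extension identifies the two. *)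
Lemma boundary_rep_choquet :
  (forall (H : hilbertType R) (pi : C(X; R) -> B(H)),
    star_rep pi -> irreducible pi -> boundary_rep M pi) ->
  forall x, choquet M x.
Proof.
move=> all_boundary x phi sphi phiM f.
pose e := l2_basis tt : l2_hilbert R unit.
have e1 : (e : l2 R unit) tt = 1 by [].
pose pi : C(X; R) -> B(l2_hilbert R unit) := eval_rep X_compact (fun=> x).
have pi_irr : irreducible pi.
  split.
    exists e; apply/eqP => e0; have := e1; rewrite e0 => /eqP.
    by rewrite -[(0 : l2_hilbert R unit) tt]/(0 : R[i]) eq_sym oner_eq0.
  move=> V [V0 Vlin _ _]; have [[v [Vv v0]]|nV] := pselect (exists v, V v /\ v <> 0).
    right; apply/seteqP; split=> // w _.
    have vt : ((v : l2 R unit) tt : R[i]) != 0.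
      by apply: contra_not_neq v0 => vt; apply: l2P => -[].
    have -> : w = (((w : l2 R unit) tt : R[i]) / (v : l2 R unit) tt) *: v + 0.
      rewrite addr0; apply: l2P => -[].
      by rewrite -[RHS]/(_ / (v : l2 R unit) tt * (v : l2 R unit) tt) divfK.
    exact: Vlin.
  left; apply/seteqP; split=> [v Vv|_ ->] //=.
  by apply: contrapT => v0; apply: nV; exists v.
have [_ uep _] := all_boundary _ pi (eval_rep_star_rep X_compact _) pi_irr.
have sphi' (i : unit) : state phi by [].
have := uep (diag_map X_compact sphi') (diag_map_ucp X_compact sphi').
have agree g : M g -> diag_map X_compact sphi' g = pi g.
  by move=> Mg; apply/bopP => v; apply: l2P => i; rewrite diag_mapE eval_repE phiM.
move=> /(_ agree) psi_pi.
have : (diag_map X_compact sphi' f e : l2 R unit) tt = (pi f e : l2 R unit) tt.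
  by rewrite psi_pi.
by rewrite diag_mapE eval_repE e1 !mulr1.
Qed.

(** Since [pi] and [psi] agree on [M], the algebra generated by the range of [psi] contains all of
    [pi(C(X))]; commutativity lets [psi f] pass through every [pi g]. *)
Lemma choquet_ucp_commutative (H : hilbertType R) (pi psi : C(X; R) -> B(H)) :
  cstar_CX M = setT -> (forall x, choquet M x) -> star_rep pi -> ucp psi ->
  (forall S T, cstar_BH (range psi) S -> cstar_BH (range psi) T -> S * T = T * S) ->
  (forall g, M g -> psi g = pi g) -> psi = pi.
Proof.
move=> M_gen allCh pi_rep psi_ucp psi_comm psiM.
have comm f g v : psi f (pi g v) = pi g (psi f v).
  rewrite -!bop_mulE psi_comm //; first by apply: sub_cstar_generated; exists f.
  apply: (star_rep_generated X_compact M_gen) => // h Mh.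
  by apply: sub_cstar_generated; exists h => //; exact: psiM.
(* Agreement on conjugates extends it to the real parts of functions in [M], which serve as
   majorants. *)
have psi_conj g : M g -> psi (cconj g) = pi (cconj g).
  move=> Mg; apply/bopP => u; apply: inner_ext => v.
  by rewrite (ucp_inner X_compact psi_ucp) cconjK psiM // (star_rep_inner pi_rep) cconjK.
have le_eps f (e : R) v : cconj f = f -> 0 < e ->
    '<psi f v, v> <= '<pi (f + e%:C *: (1 : C(X; R))) v, v>.
  move=> fr e0; pose fe := f + e%:C *: (1 : C(X; R)).
  (* The inequality is localised by a weight [q]. It is additive in [q], so compactness yields a
     weight positive everywhere, which is then divided out. *)
  pose P (U : set X) := exists q, [/\ cpos q, forall y, U y -> 0 < fre q y
    & forall v, '<psi f (pi q v), v> <= '<pi (fe * q) v, v> ].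
  have [q [qpos q0 qle]] : P setT.
    apply: compact_induction => //.
    - exists 0; split=> // u.
      by rewrite mulr0 (star_rep0 pi_rep) !bopE bop0 inner0l.
    - by move=> A B AB [q [? qB ?]]; exists q; split=> // y /AB; exact: qB.
    - move=> A B [q [q0 qA qle]] [r [r0 rB rle]]; exists (q + r); split.
      + by move=> y; rewrite cfunE addr_ge0.
      + move=> y AB; rewrite freD.
        have := cpos_fre y q0; have := cpos_fre y r0.
        by case: AB => [/qA|/rB]; lra.
      + move=> u; rewrite mulrDr !(star_repD pi_rep) !bopE bopD !innerDl.
        by rewrite lerD.
    move=> x; have [g [Mg fg gx]] := choquet_majorant X_compact M_space f (allCh x) e0.
    (* The weight is the positive part of [k], so that [g <= f + e] in real parts wherever it is
       nonzero. *)
    pose k y := fre f y + e - fre g y.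
    have kc : continuous k.
      move=> y; apply: (@cvgB R R^o); last exact: continuous_fre.
      by apply: (@cvgD R R^o); [exact: continuous_fre | exact: cvg_cst].
    pose q := rfun (continuous_maxr0 kc); pose h := rfun (@continuous_fre _ _ g).
    have qpos : cpos q by move=> y; rewrite rfunE ler0c le_max lexx orbT.
    have [s sr ss] := cpos_sqrt qpos.
    have psih : psi h = pi h.
      have -> : h = 2%:R^-1 *: (g + cconj g).
        by apply: cfunP => y; rewrite !cfunE rfunE mulrC; exact: ReJ_add.
      rewrite (ucpZ psi_ucp) (ucpD psi_ucp) psi_conj // psiM //.
      by rewrite -(star_repD pi_rep) -(star_repZ pi_rep).
    exists [set y | 0 < k y].
      by apply: (@cvgr_gt R _ _ _ _ _ (kc x)); rewrite /k; lra.
    exists q; split=> // [y ky|u]; first by rewrite /fre rfunE /= lt_max ky.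
    (* With [s] the square root of [q], commutation turns the weighted form of [psi f] at [u] into
       its plain form at [w]. *)
    set w := pi s u.
    have sa a : '<pi s a, u> = '<a, w> by rewrite (star_rep_inner pi_rep) sr.
    have -> : '<psi f (pi q u), u> = '<psi f w, w>.
      by rewrite -ss (star_repM pi_rep) bop_mulE comm sa.
    apply: le_trans (_ : '<psi h w, w> <= _).
      rewrite -subr_ge0 -innerNl -innerDl -bop_oppE -bop_addE -(ucpB psi_ucp).
      apply: (ucp_ge0 psi_ucp) => y.
      by rewrite !cfunE rfunE (cfun_real _ fr) subr_ge0 lecR fg.
    rewrite psih -sa /w -!bop_mulE -!(star_repM pi_rep) mulrAC ss [q * h]mulrC.
    rewrite -subr_ge0 -innerNl -innerDl -bop_oppE -bop_addE -(star_repB pi_rep) -mulrBl.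
    apply: (star_rep_ge0 pi_rep) => y; rewrite !cfunE !rfunE mulr1 (cfun_real _ fr).
    rewrite -rmorphD -rmorphB -rmorphM ler0c -/(k y) /=.
    have [ky|ky] := leP 0 (k y); last by rewrite mulr0.
    by rewrite mulr_ge0.
  have ci : continuous (fun y => (fre q y)^-1).
    by move=> y; apply: (@cvgV R); [rewrite gt_eqF // q0 | exact: continuous_fre].
  have ipos : cpos (rfun ci) by move=> y; rewrite rfunE ler0c invr_ge0 ltW // q0.
  (* Testing the weighted inequality at [pi r v], where [r] is the inverse square root of [q],
     removes the weight. *)
  have [r rr rri] := cpos_sqrt ipos.
  have qrr : q * (r * r) = 1.
    apply: cfunP => y; rewrite rri !cfunE rfunE (ger0_complexE (qpos y)) -rmorphM.
    by rewrite mulfV // gt_eqF // q0.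
  have ra a : '<pi r a, v> = '<a, pi r v> by rewrite (star_rep_inner pi_rep) rr.
  have e1 : pi r (pi q (pi r v)) = v.
    by rewrite -!bop_mulE -!(star_repM pi_rep) mulrAC mulrC qrr (star_rep1 pi_rep) bop_oneE.
  have e2 : pi r (pi (fe * q) (pi r v)) = pi fe v.
    by rewrite -!bop_mulE -!(star_repM pi_rep) mulrAC mulrC -mulrA qrr mulr1.
  by have := qle (pi r v); rewrite -!ra -comm e1 e2.
have le_real f v : cconj f = f -> '<psi f v, v> <= '<pi f v, v>.
  move=> fr; rewrite -subr_ge0; apply: (complex_ge0_eps (inner_ge0 v)) => e e0.
  have := le_eps f e v fr e0.
  rewrite (star_repD pi_rep) (star_repZ pi_rep) (star_rep1 pi_rep) !bopE innerDl innerZl.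
  by rewrite -subr_ge0 addrAC.
have eq_real (h : X -> R) (hc : continuous h) : psi (rfun hc) = pi (rfun hc).
  apply: bop_diag_ext => v; apply/eqP; rewrite eq_le le_real ?cconj_rfun //=.
  have := @le_real (- rfun hc) v.
  rewrite (ucpN psi_ucp) (star_repN pi_rep) !bopE !innerNl lerN2; apply.
  by apply: cfunP => y; rewrite !cfunE rmorphN !rfunE; congr (- _); exact: conjc_real.
apply/funext => f; rewrite (cfun_re_im f) (ucpD psi_ucp) (ucpZ psi_ucp).
by rewrite (star_repD pi_rep) (star_repZ pi_rep) !eq_real.
Qed.

End Boundary.

Section OperatorNorm.
Context {R : realType} {H : hilbertType R}.

Lemma bop_bounded (T : B(H)) : exists b : R, forall x, rnorm x <= 1 -> rnorm (T x) <= b.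
Proof.
have /cvg_rnormP/(_ 1 ltr01) := @bop_continuous _ _ T 0.
move/nbhs_ballP => [d' d'_gt0 dT]; have [d0 dE] := gtr0_complexP d'_gt0.
set d := complex.Re d' in d0 dE.
(* Scaling by [d / 2] puts the unit ball strictly inside the ball of radius [d], on which [T] has
   norm below 1. *)
exists (2 / d) => x x1; have d2 : 0 < d / 2 by rewrite divr_gt0.
have : rnorm (T 0 - T ((d / 2)%:C *: x)) < 1.
  apply: dT; rewrite -ball_normE /ball_ /= sub0r normrN dE -rnormE ltcR.
  rewrite rnormZ rnormC gtr0_norm //.
  apply: le_lt_trans (_ : d / 2 < _); first by rewrite ler_piMr // ltW.
  by rewrite ltr_pdivrMr // ltr_pMr // ltr1n.
rewrite bop0 sub0r rnormN bopZ rnormZ rnormC gtr0_norm // => h.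
rewrite ler_pdivlMr // (_ : rnorm (T x) * d = 2 * (d / 2 * rnorm (T x))); last by field.
by rewrite -[leRHS]mulr1 ler_pM2l // ltW.
Qed.

Lemma rnorm_opnorm (T : B(H)) x : rnorm (T x) <= opnorm T * rnorm x.
Proof.
have [->|x0] := eqVneq x 0; first by rewrite bop0 !rnorm0 mulr0.
have N0 : 0 < rnorm x.
  by rewrite lt_def rnorm_ge0 andbT; apply: contra_neq x0; exact: rnorm_eq0.
have [b Tb] := bop_bounded T.
rewrite -ler_pdivrMr // mulrC -[X in X * _](ger0_norm (_ : 0 <= _)) ?invr_ge0 ?rnorm_ge0 //.
rewrite -rnormC -rnormZ -bopZ; apply: ub_le_sup.
  by exists b => _ [y /= y1 <-]; exact: Tb.
exists ((rnorm x)^-1%:C *: x) => //=.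
by rewrite rnormZ rnormC ger0_norm ?invr_ge0 ?rnorm_ge0 // mulVf ?gt_eqF.
Qed.

End OperatorNorm.

(** * The algebra of diagonal operators *)

Section DiagonalAlgebra.
Context {R : realType} {I : choiceType}.
Local Notation H := (l2_hilbert R I).

Definition is_diag (S : B(H)) : Prop :=
  exists d : I -> R[i], forall (x : H) i, (S x : l2 R I) i = d i * ((x : l2 R I) i : R[i]).

Lemma is_diag_mulC (S T : B(H)) : is_diag S -> is_diag T -> S * T = T * S.
Proof.
move=> [d Sd] [c Tc]; apply/bopP => x; apply: l2P => i.
by rewrite !bop_mulE !Sd !Tc !Sd mulrCA.
Qed.

(** With [is_diag_mulC], this makes commutative the C*-algebra generated by any set of diagonal
    operators. *)
Lemma is_diag_subalgebra : @cstar_subalgebra R B(H) *%R adj opnorm is_diag.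
Proof.
split.
- by exists (fun=> 0) => x i; rewrite bop_zeroE mul0r.
- move=> a S T [d Sd] [c Tc]; exists (fun i => a * d i + c i) => x i.
  by rewrite bop_addE bop_scaleE l2_addE l2_scaleE Sd Tc mulrDl mulrA.
- move=> S T [d Sd] [c Tc]; exists (fun i => d i * c i) => x i.
  by rewrite bop_mulE Sd Tc mulrA.
(* The default value 0 of [adj] is diagonal too; a genuine adjoint has the conjugate entries. *)
- move=> S [d Sd]; rewrite /adj; case: xgetP => [T _ ST|_]; last first.
    by exists (fun=> 0) => x i; rewrite bop_zeroE mul0r.
  exists (fun i => Num.conj (d i)) => x i.
  rewrite -[LHS]inner_l2_basis innerC -ST.
  have -> : S (l2_basis i) = d i *: (l2_basis i : H).
    apply: l2P => j; rewrite Sd -[RHS]/(d i * (j == i)%:R) l2_basisE.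
    by have [->|_] := eqVneq j i; rewrite ?mulr0.
  rewrite innerZl rmorphM; congr (_ * _).
  exact: etrans (esym (innerC _ _)) (inner_l2_basis x i).
move=> S Sap; exists (fun i => (S (l2_basis i) : l2 R I) i) => x i.
apply/eqP; rewrite -subr_eq0; apply/eqP/(@rnorm_eq0 R R[i]^o).
apply/eqP; rewrite eq_le rnorm_ge0 andbT; apply/ler_addgt0Pr => e e0; rewrite add0r.
(* Subtracting a diagonal [T] leaves two error terms, each at most [e / b * rnorm x]; the [+ 1]
   keeps [b] positive when [x = 0]. *)
pose b := 2 * (rnorm x + 1); have b0 : 0 < b.
  by rewrite mulr_gt0 // ltr_wpDl ?rnorm_ge0.
have [T [d Td] ST] := Sap (e / b) (divr_gt0 e0 b0).
have STn (y : H) : rnorm (((S - T) y : l2 R I) i) <= e / b * rnorm y.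
  apply: le_trans (l2_coord_le _ i) _; apply: le_trans (rnorm_opnorm (S - T) y) _.
  by rewrite ler_wpM2r ?rnorm_ge0 // ltW.
have -> : (S x : l2 R I) i - (S (l2_basis i) : l2 R I) i * (x : l2 R I) i =
    ((S - T) x : l2 R I) i - (((x : l2 R I) i : R[i]) *: (((S - T) (l2_basis i) : l2 R I) i)).
  rewrite !(bop_addE, bop_oppE) !(l2_addE, l2_oppE) !Td -[_ *: _]/(_ * _) l2_basisE eqxx.
  have alg (z w u v : R[i]) : z - w * u = z - v * u - u * (w - v * 1%:R) by ring.
  exact: alg.
apply: le_trans (rnormD _ _) _; rewrite rnormN rnormZ.
have h1 := STn x; have := STn (l2_basis i); rewrite rnorm_l2_basis mulr1 => h2.
have h3 : rnorm ((x : l2 R I) i) <= rnorm x := l2_coord_le _ i.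
apply: le_trans (_ : e / b * rnorm x + rnorm x * (e / b) <= _).
  by rewrite lerD // ler_pM ?rnorm_ge0.
rewrite [X in _ + X]mulrC -mulr2n -mulr_natl mulrA.
rewrite (_ : 2 * (e / b) * rnorm x = e * (2 * rnorm x) / b); last by ring.
rewrite ler_pdivrMr //; apply: ler_wpM2l; first exact: ltW.
by rewrite /b mulrDr mulr1 lerDl ler0n.
Qed.

End DiagonalAlgebra.

Section L2Vanish.
Context {R : realType} {I : choiceType}.

(** If a finite sum over [A] comes within [e ^+ 2] of the total, one further coordinate contributes
    less than [e ^+ 2]. *)
Lemma l2_vanish (x : l2 R I) (e : R) : 0 < e ->
  exists A : {fset I}, forall i, i \notin A -> rnorm (x i) < e.
Proof.
move=> e0; have [s hs [les sle]] := l2_sqsum x.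
have [A hA] : exists A : {fset I}, s - e ^+ 2 < \sum_(i <- A) rnorm (x i) ^+ 2.
  apply: contrapT => nA; have : s <= s - e ^+ 2.
    by apply: sle => A; rewrite leNgt; apply/negP => hA; apply: nA; exists A.
  by rewrite leNgt gtrBl exprn_gt0.
exists A => i iA; rewrite -ltr_sqr ?nnegrE ?rnorm_ge0 ?(ltW e0) //.
have := les (i |` A)%fset; rewrite big_fsetU1 //=; move: hA.
move: (rnorm (x i) ^+ 2) (\sum_(i <- A) _) (e ^+ 2) => a b c; lra.
Qed.

End L2Vanish.

(** * The representation attached to a non-Choquet point *)

Section ApproximateUniqueness.
Context {R : realType} {X : topologicalType}.
Context (X_compact : compact [set: X]) (X_hausdorff : hausdorff_space X).
Context (M : set C(X; R)) (M_space : unital_function_space M).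
Context (M_envelope : is_cstar_envelope M).
Context (x0 : X) (x0_choquet : ~ choquet M x0).
Implicit Types f g t : C(X; R).

Let I := set_type [set y | choquet M y \/ y = x0].
Let p (i : I) : X := val i.
Let i0 : I := SigSub (mem_set (or_intror (choquet M x0) (erefl x0)) :
  x0 \in [set y | choquet M y \/ y = x0]).
Local Notation H := (l2_hilbert R I).
Let pi : C(X; R) -> B(H) := eval_rep X_compact p.
Let e (i : I) : H := l2_basis i.

Let p_choquet i : i != i0 -> choquet M (p i).
Proof.
move=> ii0; have [//|pi0] := set_mem (valP i).
by case/eqP: ii0; exact: val_inj.
Qed.

Let pi_basis t i : pi t (e i) = (t (p i) : R[i]) *: e i.
Proof.
apply: l2P => j; rewrite eval_repE -[RHS]/((t (p i) : R[i]) * (j == i)%:R).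
by rewrite l2_basisE; have [->|_] := eqVneq j i; rewrite ?mulr0.
Qed.

Let e_orthonormal i j : '<e i, e j> = (j == i)%:R.
Proof. by rewrite inner_l2_basis. Qed.

Section Extension.
Context (psi : C(X; R) -> B(H)) (psi_ucp : ucp psi).
Hypothesis psiM : forall g, M g -> psi g = pi g.

Let c t : R[i] := '<psi t (e i0), e i0>.

Lemma psi_basis t i : i != i0 -> psi t (e i) = (t (p i) : R[i]) *: e i.
Proof.
move=> /p_choquet pCh; move: t; apply: (choquet_eigenvector X_compact pCh psi_ucp).
by move=> g Mg; rewrite psiM // pi_basis.
Qed.

Lemma psi_coord t (x : H) i : i != i0 -> '<psi t x, e i> = (t (p i) : R[i]) * '<x, e i>.
Proof.
move=> ii0; rewrite (ucp_inner X_compact psi_ucp) psi_basis // innerZr cconjE conjCK.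
by [].
Qed.

(** The other coordinates vanish by [psi_coord]. Hence [psi t] is diagonal, with entries [t (p i)]
    for [i != i0] and [c t] at [i0]. *)
Lemma psi_basis0 t : psi t (e i0) = c t *: e i0.
Proof.
apply: l2P => i; rewrite -[LHS]inner_l2_basis -[RHS]inner_l2_basis innerZl.
have [->|ii0] := eqVneq i i0; first by rewrite e_orthonormal eqxx mulr1.
by rewrite psi_coord // e_orthonormal (negPf ii0) !mulr0.
Qed.

Lemma psi_coord0 t (x : H) : '<psi t x, e i0> = c t * '<x, e i0>.
Proof.
rewrite (ucp_inner X_compact psi_ucp) psi_basis0 innerZr; congr (_ * _).
by rewrite /c -innerC -(ucp_inner X_compact psi_ucp).
Qed.

Lemma pi_psi t (x : H) :
  pi t x = psi t x + (((t x0 : R[i]) - c t) * '<x, e i0>) *: e i0.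
Proof.
apply: l2P => i; rewrite eval_repE -[(x : l2 R I) i]inner_l2_basis.
rewrite -[RHS]inner_l2_basis innerDl innerZl e_orthonormal.
have [->|ii0] := eqVneq i i0; first by rewrite psi_coord0 mulr1; ring.
by rewrite psi_coord // mulr0 addr0.
Qed.

(** Conjugation exchanges the diagonal entries [c t] at [i0] and [t (p i)] at [i]; the correction is
    the resulting change at these two coordinates. *)
Lemma reflection_psi t (x z : H) i : i != i0 ->
  '<(adj (reflection (e i0 - e i)) * psi t * reflection (e i0 - e i) : B(H)) x, z> =
  '<psi t x, z> + ((t (p i) : R[i]) - c t) *
    ('<x, e i0> * '<e i0, z> - '<x, e i> * '<e i, z>).
Proof.
move=> ii0; rewrite !bop_mulE adj_reflection.
rewrite reflection_inner !reflectionE bopB bopZ bopB psi_basis0 psi_basis //.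
rewrite !(innerDl, innerDr, innerNl, innerNr, innerZl, innerZr) !psi_coord0 !psi_coord //.
rewrite !e_orthonormal !eqxx (negPf ii0) eq_sym (negPf ii0).
have -> : Num.conj ('<z, e i0> - '<z, e i>) = '<e i0, z> - '<e i, z>.
  by rewrite rmorphB; congr (_ - _); exact: esym (innerC _ _).
move: '<psi t x, z> (c t) (t (p i) : R[i]) '<x, e i0> '<x, e i> '<e i0, z> '<e i, z>.
rewrite (_ : true%:R = 1 :> R[i]) // (_ : false%:R = 0 :> R[i]) //.
by move=> a b k x1 x2 z1 z2; ring.
Qed.

End Extension.

(** No [p i] with [i != i0] equals [x0], since [x0] is not a Choquet point; finitely many such
    points can be removed from a neighbourhood. *)
Let nbhs_avoid (A : {fset I}) :
  nbhs x0 [set y | forall i, i \in A -> i != i0 -> y <> p i].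
Proof.
suff h (s : seq I) : nbhs x0 [set y | forall i, i \in s -> i != i0 -> y <> p i].
  exact: h.
elim: s => [|i s IHs]; first by apply: filterS filterT => y _ i; rewrite in_nil.
have [->|ii0] := eqVneq i i0.
  apply: filterS IHs => y ys j; rewrite inE => /orP[/eqP ->|]; last exact: ys.
  by rewrite eqxx.
have ni : nbhs x0 (~` [set p i]).
  apply: open_nbhs_nbhs; split; last first.
    by move=> /= x0i; apply: x0_choquet; rewrite x0i; exact: p_choquet.
  by apply/closed_openC/accessible_closed_set1; exact: hausdorff_accessible.
apply: filterS2 ni IHs => y yi ys j; rewrite inE => /orP[/eqP -> _|]; last exact: ys.
exact: yi.
Qed.

(** As the points [p (i_ U)] approach [x0], the indices leave every finite set, outside which the
    coordinates of [x] are small. *)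
Let coord_cvg0 (i_ : nbhs_directed x0 -> I) (x : H) :
  (forall U, i_ U != i0 /\ sval (U : {U : set X | nbhs x0 U}) (p (i_ U))) ->
  ('<x, e (i_ U)> : R[i]^o) @[U --> tails (nbhs_directed x0)] --> (0 : R[i]^o).
Proof.
move=> iP; apply/cvg_rnormP => d d0; have [A hA] := l2_vanish (x : l2 R I) d0.
exists (exist (fun U => nbhs x0 U) _ (nbhs_avoid A)) => U UV.
rewrite sub0r rnormN inner_l2_basis; apply: hA; apply/negP => iA.
have [ii0 Ui] := iP U.
exact: (UV _ Ui (i_ U) iA ii0 erefl).
Qed.

(** As [p (i_ U)] tends to [x0], the correction in [reflection_psi] tends to
    [(t x0 - c t) '<x, e i0> '<e i0, z>], which is the difference of [pi t] and [psi t] found in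
    [pi_psi]. *)
Lemma approx_unique_extension_eval : approx_unique_extension M pi.
Proof.
move=> psi psi_ucp psiM; pose D := nbhs_directed x0.
have /choice[i_ iP] (U : D) : exists i : I,
    i != i0 /\ sval (U : {U : set X | nbhs x0 U}) (p i).
  have [y yCh Uy] := choquet_dense X_compact X_hausdorff M_space M_envelope
    (svalP (U : {U : set X | nbhs x0 U})).
  exists (SigSub (mem_set (or_introl yCh) : y \in [set y | choquet M y \/ y = x0])).
  split=> //; apply/eqP => /(congr1 val) /= yx0.
  by apply: x0_choquet; rewrite -yx0.
exists D, (fun U => reflection (e i0 - e (i_ U))); split=> [U|t x z].
  have [ii0 _] := iP U; apply: unitary_reflection.
  rewrite !(innerDl, innerDr, innerNl, innerNr) !e_orthonormal !eqxx (negPf ii0).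
  rewrite eq_sym (negPf ii0) (_ : true%:R = 1 :> R[i]) // (_ : false%:R = 0 :> R[i]) //.
  by ring.
pose c := '<psi t (e i0), e i0>.
rewrite (_ : (fun U => _) = fun U : D => '<psi t x, z> + ((t (p (i_ U)) : R[i]) - c) *
    ('<x, e i0> * '<e i0, z> - '<x, e (i_ U)> * '<e (i_ U), z>) : R[i]^o); last first.
  by apply/funext => U; have [ii0 _] := iP U; rewrite reflection_psi.
rewrite (pi_psi psi_ucp psiM) innerDl innerZl -/c.
(* The term [0 * 0] is the limit of the product of the coordinates of [x] and [z] at [i_ U]. *)
rewrite (_ : ((t x0 : R[i]) - c) * '<x, e i0> * '<e i0, z> =
  ((t x0 : R[i]) - c) * ('<x, e i0> * '<e i0, z> - 0 * 0)); last first.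
  by rewrite mul0r subr0 mulrA.
apply: (@cvgD R[i] R[i]^o); first exact: cvg_cst.
apply: (@cvgM R[i]).
  apply: (@cvgB R[i] R[i]^o); last exact: cvg_cst.
  apply: (@cvg_nbhs_directed X x0 R[i]^o t (fun U => p (i_ U))) => [U|].
    by have [] := iP U.
  exact: cts_fun.
apply: (@cvgB R[i] R[i]^o); first exact: cvg_cst.
apply: (@cvgM R[i]); first exact: coord_cvg0.
have := coord_cvg0 z iP => /cvg_rnormP zc; apply/(@cvg_rnormP R R[i]^o) => d d0.
apply: filterS (zc d d0) => U; rewrite !sub0r !rnormN.
by rewrite (innerC (e (i_ U)) z) /rnorm norm_conjC.
Qed.

(** Replacing evaluation at [x0] by [phi] in the diagonal yields [psi], which agrees with [pi] on
    [M] and has diagonal, hence commutative, range. Comparing entries at [i0] gives [phi f = f x0],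
    contrary to the choice of [x0]. *)
Lemma commutative_uniqueness_contra :
  (forall (H : hilbertType R) (pi psi : C(X; R) -> B(H)),
    star_rep pi -> approx_unique_extension M pi -> ucp psi ->
    (forall S T, cstar_BH (range psi) S -> cstar_BH (range psi) T -> S * T = T * S) ->
    (forall g, M g -> psi g = pi g) -> psi = pi) ->
  choquet M x0.
Proof.
move=> uniq phi sphi phiM f.
pose lam (i : I) g := if i == i0 then phi g else (g (p i) : R[i]).
have slam i : state (lam i).
  by rewrite /lam; case: (i == i0) => //; exact: eval_state.
pose psi : C(X; R) -> B(H) := diag_map X_compact slam.
have psi_pi : psi = pi.
  apply: uniq; [exact: eval_rep_star_rep | exact: approx_unique_extension_eval
    | exact: diag_map_ucp | |].
    have gen_diag S : cstar_BH (range psi) S -> is_diag S.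
      apply: cstar_generated_ind; first exact: is_diag_subalgebra.
      by move=> _ [g _ <-]; exists (fun i => lam i g).
    by move=> S T /gen_diag dS /gen_diag dT; exact: is_diag_mulC.
  move=> g Mg; apply/bopP => v; apply: l2P => i; rewrite diag_mapE eval_repE /lam.
  by have [->|//] := eqVneq i i0; rewrite phiM.
have <- : (psi f (e i0) : l2 R I) i0 = phi f.
  by rewrite diag_mapE /lam eqxx l2_basisE eqxx mulr1.
by rewrite psi_pi eval_repE l2_basisE eqxx mulr1.
Qed.

End ApproximateUniqueness.

Theorem proposition5p1 (R : realType) (X : topologicalType)
    (X_compact : compact [set: X]) (X_hausdorff : hausdorff_space X)
    (M : set C(X; R)) (M_space : unital_function_space M)
    (M_envelope : is_cstar_envelope M) :
  [<->
    forall (H : hilbertType R) (pi psi : C(X; R) -> B(H)),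
      star_rep pi -> approx_unique_extension M pi ->
      ucp psi ->
      (forall S T, cstar_BH (range psi) S -> cstar_BH (range psi) T ->
        S * T = T * S) ->
      (forall g, M g -> psi g = pi g) ->
      psi = pi;

    forall (D : directedType) (psi : D -> C(X; R) -> C(X; R)),
      (forall a, ucp_CX (psi a)) ->
      (forall g, M g -> supnorm (psi a g - g) @[a --> tails D] --> (0 : R)) ->
      forall f, supnorm (psi a f - f) @[a --> tails D] --> (0 : R);

    forall (H : hilbertType R) (pi : C(X; R) -> B(H)),
      star_rep pi -> irreducible pi -> boundary_rep M pi].
Proof.
(* Each implication of the cycle passes through the statement that every point is a Choquet
   point. *)
tfae=> [uniq|korovkin|all_boundary].
- apply: (choquet_Korovkin X_compact M_space) => x; apply: contrapT => nCh; apply: (nCh).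
  exact: (commutative_uniqueness_contra X_compact X_hausdorff M_space M_envelope nCh uniq).
- apply: (choquet_boundary_rep X_compact).
  exact: (Korovkin_choquet X_compact X_hausdorff korovkin).
- move=> H pi psi pi_rep _ psi_ucp psi_comm psiM.
  apply: (choquet_ucp_commutative X_compact M_space M_envelope.1 _
    pi_rep psi_ucp psi_comm psiM).
  exact: (boundary_rep_choquet X_compact all_boundary).
Qed.
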